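(* Let $\mathfrak g$ be a complex semi-simple Lie algebra with Cartan subalgebra $\mathfrak h$ and root system $R\subset\mathfrak h^*$, let $\mathfrak h_{\mathrm{reg}}=\mathfrak h\setminus\bigcup_{\alpha\in R}\operatorname{Ker}(\alpha)$, and let $U$ be a finite-dimensional $\mathfrak g$-module. For any $h\in\mathbb C$, the Casimir connection $$\nabla_{C}=d-h\sum_{\alpha\succ 0}\frac{d\alpha}{\alpha}\cdot C_{\alpha}$$ on the trivial vector bundle $\mathfrak h_{\mathrm{reg}}\times U$ over $\mathfrak h_{\mathrm{reg}}$ is flat, and it is reducible with respect to the weight space decomposition of $U$, i.e. it preserves each subbundle $\mathfrak h_{\mathrm{reg}}\times U[\mu]$, where $U[\mu]\subseteq U$ is the weight space of weight $\mu\in\mathfrak h^*$.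
   Context: The notation $\alpha\succ0$ means that the sum runs over a fixed choice of positive roots of $R$. $\langle\cdot,\cdot\rangle$ denotes the basic inner product on $\mathfrak g$, i.e. the multiple of the Killing form for which the highest root has squared length $2$ (normalised in this way on each simple ideal of $\mathfrak g$), and also the induced form on $\mathfrak h^*$. For each root $\alpha$, $\mathfrak{sl}_2^\alpha\subseteq\mathfrak g$ is the subalgebra spanned by $e_\alpha,f_\alpha,h_\alpha$, where $h_\alpha=\alpha^\vee\in\mathfrak h$ is the coroot of $\alpha$ and $e_\alpha,f_\alpha$ are root vectors for $\alpha,-\alpha$ normalised by $[e_\alpha,f_\alpha]=h_\alpha$. The Casimir element of $\mathfrak{sl}_2^\alpha$ relative to the restriction of $\langle\cdot,\cdot\rangle$ is $$C_\alpha=\frac{\langle\alpha,\alpha\rangle}{2}\left(e_\alpha f_\alpha+f_\alpha e_\alpha+\tfrac12 h_\alpha^2\right)\in U\mathfrak{sl}_2^\alpha\subseteq U\mathfrak g,$$ where $U\mathfrak g$ is the universal enveloping algebra; in the connection $C_\alpha$ acts on the fibre via the $\mathfrak g$-module structure. *)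

(* Defs.v *)
From HB Require Import structures.
From mathcomp Require Import all_boot all_order all_algebra.
From mathcomp Require Import complex.
From mathcomp Require Import all_classical all_reals topology normedtype derive.

Set Implicit Arguments.
Unset Strict Implicit.
Unset Printing Implicit Defensive.

Import Order.TTheory GRing.Theory Num.Theory.
Import numFieldNormedType.Exports.
Import passmx.

Local Open Scope classical_set_scope.
Local Open Scope ring_scope.

(** * Finite-dimensional Lie algebras *)

HB.mixin Record Vector_isLieAlgebra (K : fieldType) g of Vector K g := {
  lie : g -> g -> g;
  lie_linearl : forall (a : K) (x y z : g),
    lie (a *: x + y) z = a *: lie x z + lie y z;
  lie_linearr : forall (a : K) (x y z : g),
    lie z (a *: x + y) = a *: lie z x + lie z y;
  lie_alt : forall x : g, lie x x = 0;
  lie_jacobi : forall x y z : g,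
    lie x (lie y z) + lie y (lie z x) + lie z (lie x y) = 0
}.

#[short(type="lieAlgType")]
HB.structure Definition LieAlgebra (K : fieldType) :=
  {g of Vector_isLieAlgebra K g & Vector K g}.

Section LieTheory.
Variables (K : fieldType) (g : lieAlgType K).
Implicit Types (x y z : g) (I J A B : {vspace g}).

(* The span of all brackets [a, b], a in A and b in B. *)
Definition lie_span A B : {vspace g} :=
  <<[seq lie a b | a <- vbasis A, b <- vbasis B]>>%VS.

Definition lie_solvable A : Prop :=
  exists n, iter n (fun D => lie_span D D) A = 0%VS.

Definition lie_nilpotent A : Prop :=
  exists n, iter n (lie_span A) A = 0%VS.

Definition lie_subalgebra A : Prop :=
  forall x y, x \in A -> y \in A -> lie x y \in A.

Definition lie_ideal I : Prop := forall x y, y \in I -> lie x y \in I.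

(* The solvable radical vanishes. *)
Definition lie_semisimple : Prop :=
  forall I, lie_ideal I -> lie_solvable I -> I = 0%VS.

(* An ideal which is simple as a Lie algebra: not abelian, and with no ideals
   of its own other than 0 and itself. *)
Definition simple_ideal I : Prop :=
  [/\ lie_ideal I,
      exists x y, [/\ x \in I, y \in I & lie x y != 0] &
      forall J, (J <= I)%VS ->
        (forall x y, x \in I -> y \in J -> lie x y \in J) ->
        J = 0%VS \/ J = I].

Definition ad x : 'End(g) := linfun (lie x).

Definition lfun_trace (V : vectType K) (f : 'End(V)) : K :=
  \tr (mxof (vbasis {:V}) (vbasis {:V}) f).

Definition killing x y : K := lfun_trace (ad x \o ad y)%VF.

(* Nilpotent and equal to its own normalizer. *)
Definition cartan_subalgebra (H : {vspace g}) : Prop :=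
  [/\ lie_subalgebra H, lie_nilpotent H &
      forall x, (forall y, y \in H -> lie x y \in H) -> x \in H].

Definition lie_module (U : vectType K) (rho : 'Hom(g, 'End(U))) : Prop :=
  forall x y, rho (lie x y) = ((rho x \o rho y) - (rho y \o rho x))%VF.

End LieTheory.

(** * Roots and weights with respect to H *)

Section Roots.
Variables (K : fieldType) (g : lieAlgType K) (H : {vspace g}).

(* H^*; vectors of H live in [subvs_of H], and [vsval] embeds them in g. *)
Definition cdual := 'Hom(subvs_of H, K^o).

Definition weight_space (U : vectType K) (rho : 'Hom(g, 'End(U)))
    (mu : cdual) : set U :=
  [set u | forall x : subvs_of H, rho (vsval x) u = (mu x : K) *: u].

Definition root_space (alpha : cdual) : set g :=
  [set y | forall x : subvs_of H, lie (vsval x) y = (alpha x : K) *: y].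

Definition is_root (alpha : cdual) : Prop :=
  alpha != 0 /\ exists2 y, root_space alpha y & y != 0.

Definition h_reg : set (subvs_of H) :=
  [set x | forall alpha, is_root alpha -> (alpha x : K) != 0].

(* [pos] enumerates, without repetition, a choice of positive roots. *)
Definition positive_roots (pos : seq cdual) : Prop :=
  [/\ uniq pos,
      forall alpha, alpha \in pos -> is_root alpha,
      forall alpha, is_root alpha -> (alpha \in pos) (+) (- alpha \in pos) &
      forall alpha beta, alpha \in pos -> beta \in pos ->
        is_root (alpha + beta) -> alpha + beta \in pos].

Definition root_in (I : {vspace g}) (alpha : cdual) : Prop :=
  is_root alpha /\ (forall y, root_space alpha y -> y \in I).

(* theta - beta is a sum of positive roots for every root beta of I. *)
Definition highest_root (pos : seq cdual) (I : {vspace g}) (theta : cdual) :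
    Prop :=
  root_in I theta /\
  forall beta, root_in I beta ->
    exists2 s : seq cdual, {subset s <= pos} & theta - beta = \sum_(a <- s) a.

Section Form.
Variable B : 'Hom(g, 'Hom(g, K^o)).

(* The map H -> H^* induced by the restriction of the form B to H. *)
Definition flat : 'Hom(subvs_of H, cdual) :=
  linfun (fun x : subvs_of H =>
    linfun (fun y : subvs_of H => B (vsval x) (vsval y)) : cdual).

(* [^-1%VF] is the inverse map as soon as [flat] is bijective, i.e. as soon as
   the restriction of B to H is nondegenerate. *)
Definition sharp : 'Hom(cdual, subvs_of H) := (flat^-1)%VF.

(* The form induced by B on H^*. *)
Definition dual_form (alpha beta : cdual) : K :=
  B (vsval (sharp alpha)) (vsval (sharp beta)).

Definition coroot (alpha : cdual) : subvs_of H :=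
  (2 / dual_form alpha alpha) *: sharp alpha.

(* The basic inner product.  The Killing form of an ideal is the restriction of
   the Killing form of g; the simple ideals span g when g is semisimple, so the
   conditions below determine B. *)
Record basic_inner_product (pos : seq cdual) : Prop := {
  basic_sym : forall x y, B x y = B y x;
  basic_nondeg : forall x, (forall y, B x y = 0) -> x = 0;
  basic_orthogonal : forall I J x y, simple_ideal I -> simple_ideal J ->
    I <> J -> x \in I -> y \in J -> B x y = 0;
  basic_killing : forall I, simple_ideal I ->
    exists c : K, forall x y, x \in I -> y \in I -> B x y = c * killing x y;
  basic_highest : forall I theta, simple_ideal I ->
    highest_root pos I theta -> dual_form theta theta = 2
}.

(* Root vectors e_alpha, f_alpha with [e_alpha, f_alpha] = h_alpha. *)
Definition root_vectors (e f : cdual -> g) : Prop :=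
  forall alpha, is_root alpha ->
    [/\ root_space alpha (e alpha), root_space (- alpha) (f alpha) &
        lie (e alpha) (f alpha) = vsval (coroot alpha)].

(* The action on U of the Casimir element C_alpha of sl_2^alpha. *)
Definition casimir (e f : cdual -> g) (U : vectType K)
    (rho : 'Hom(g, 'End(U))) (alpha : cdual) : 'End(U) :=
  let E := rho (e alpha) in
  let F := rho (f alpha) in
  let h := rho (vsval (coroot alpha)) in
  (dual_form alpha alpha / 2) *: ((E \o F) + (F \o E) + 2^-1 *: (h \o h))%VF.

(* The connection form of d - h sum_(alpha > 0) (d alpha / alpha) C_alpha. *)
Definition casimir_connection (pos : seq cdual) (e f : cdual -> g)
    (U : vectType K) (rho : 'Hom(g, 'End(U))) (h : K) (x : subvs_of H) :
    'Hom(subvs_of H, 'End(U)) :=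
  - (h *: \sum_(alpha <- pos)
      linfun (fun v => ((alpha v : K) / (alpha x : K)) *: casimir e f rho alpha)).

End Form.
End Roots.

(** * Connections on trivial vector bundles *)

(* A [vectType] carries no canonical norm, so topology and differentiation are
   those of K^n, read in coordinates. *)
Section Calculus.
Variables (K : numFieldType) (V W : vectType K).

Definition to_coord (E : vectType K) : E -> 'rV[K]_(\dim {:E}) :=
  rVof (vbasis {:E}).
Definition of_coord (E : vectType K) : 'rV[K]_(\dim {:E}) -> E :=
  vecof (vbasis {:E}).

Definition in_coord (F : V -> W) : 'rV[K]_(\dim {:V}) -> 'rV[K]_(\dim {:W}) :=
  @to_coord W \o F \o @of_coord V.

Definition vopen (O : set V) : Prop := open (@of_coord V @^-1` O).

Definition vdifferentiable (F : V -> W) (x : V) : Prop :=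
  differentiable (in_coord F) (to_coord x).

Definition dirderiv (v : V) (F : V -> W) (x : V) : W :=
  of_coord ('D_(to_coord v) (in_coord F) (to_coord x)).

End Calculus.

(* A one-form A with values in End(W) stands for the connection d + A on the
   trivial bundle with fibre W. *)
Section Connections.
Variables (K : numFieldType) (V W : vectType K).
Variables (Omega : set V) (A : V -> 'Hom(V, 'End(W))).

Definition covariant (v : V) (s : V -> W) (x : V) : W :=
  dirderiv v s x + A x v (s x).

(* The curvature dA + A /\ A at x, evaluated on the tangent vectors u, v. *)
Definition curvature (x u v : V) : 'End(W) :=
  dirderiv u (fun y => A y v) x - dirderiv v (fun y => A y u) x
    + ((A x u \o A x v) - (A x v \o A x u))%VF.

(* Differentiability is part of the definition: [dirderiv] is total and has no
   meaning at points where the derivative does not exist. *)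
Definition flat_connection : Prop :=
  (forall x, Omega x -> vdifferentiable A x) /\
  (forall x u v, Omega x -> curvature x u v = 0).

(* Covariant derivatives of local sections of the subbundle Omega x P remain
   sections of it. *)
Definition preserves_subbundle (P : set W) : Prop :=
  forall (O : set V) (s : V -> W), vopen O -> O `<=` Omega ->
    (forall x, O x -> vdifferentiable s x) -> (forall x, O x -> P (s x)) ->
    forall v x, O x -> P (covariant v s x).

End Connections.

(* Main.v *)
(** The form [A] is [sum_alpha (d alpha / alpha) (- h C_alpha)], so it is closed,
and [A /\ A = 0] follows from Kohno's criterion: grouping the pairs of roots by
the plane [Q] that they span, the Arnold relation among the forms
[d log alpha], [alpha] in [Q], reduces the claim to
[[C_alpha, sum_(beta in Q) C_beta] = 0].  Modulo [U(H)], this sum is the Casimir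
element of the subalgebra [H + sum_(beta in Q) g_beta], which commutes with
[e_alpha] and [f_alpha], while [C_alpha] has weight zero and commutes with [H].
The latter also gives the invariance of the weight spaces.

The structure theory this requires is obtained from one construction.  For an
endomorphism [T] and a function [phi], let [phi(T)] act as [phi(a)] on the
generalized eigenspace of [a].  If [phi] is additive and [T] is a derivation, so
is [phi(T)].  With complex conjugation for [phi], the trace of [T phi(T)] is the
sum of the [|a|^2], so [T] is nilpotent as soon as this trace vanishes; this
yields Cartan's criterion, the commutativity of [H] and the fact that roots are
not isotropic.  With the identity for [phi], it yields the Jordan decomposition
of [ad x]. *)

Require Import Defs.
From HB Require Import structures.
From mathcomp Require Import all_boot all_order all_algebra.
From mathcomp Require Import complex ring.
From mathcomp Require Import all_classical all_reals topology normedtype derive.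

Import Order.TTheory GRing.Theory Num.Theory.
Import numFieldNormedType.Exports.

Local Open Scope classical_set_scope.
Local Open Scope ring_scope.

Import passmx.

Set Implicit Arguments.
Unset Strict Implicit.
Unset Printing Implicit Defensive.

(** * Generalized eigenvectors and spectral functions *)

(** [cartan_subalgebra] asks only for nilpotency and self-normalization, so a link is needed between
    an operator such as [spectral (ad h) phi] and elements of [H]. It is provided by the fact that
    every derivation of a semisimple algebra is inner: this operator is [ad c], and since [ad h] is
    nilpotent on [H], the element [c] centralizes [H] and hence belongs to it. Additivity of [phi]
    suffices because brackets add eigenvalues; conjugation is therefore admissible although it is
    not linear over the complex numbers.

    The Casimir element attached to a plane needs dual bases consisting of root vectors, hence that
    root spaces are lines. This comes from a lowest weight argument in which only the finiteness of
    the spectrum of [ad h] enters. In the sum over pairs of roots, a pair of proportional forms has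
    zero wedge, so it may be counted in any plane that contains it. *)

Section LfunLinear.
Variables (K : fieldType) (V W : vectType K) (f : 'Hom(V, W)).

Lemma lfunD u v : f (u + v) = f u + f v. Proof. exact: linearD. Qed.
Lemma lfunB u v : f (u - v) = f u - f v. Proof. exact: linearB. Qed.
Lemma lfunN u : f (- u) = - f u. Proof. exact: linearN. Qed.
Lemma lfunZ a u : f (a *: u) = a *: f u. Proof. exact: linearZ. Qed.
Lemma lfun0 : f 0 = 0. Proof. exact: linear0. Qed.

Lemma lfun_sum I (r : seq I) (P : pred I) (F : I -> V) :
  f (\sum_(i <- r | P i) F i) = \sum_(i <- r | P i) f (F i).
Proof. exact: linear_sum. Qed.

End LfunLinear.

Section LinearAlgebra.
Variables (K : fieldType) (V : vectType K).
Implicit Types (f T : 'End(V)) (W A B : {vspace V}) (v w : V).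

Definition stable f W := forall v, v \in W -> f v \in W.

Definition pow_lfun f k : 'End(V) := iter k (comp_lfun f) \1%VF.

Lemma pow_lfunE f k v : pow_lfun f k v = iter k f v.
Proof.
rewrite /pow_lfun; elim: k => [|k IH] /=; first by rewrite id_lfunE.
by rewrite comp_lfunE IH.
Qed.

Lemma stable_iter f W k v : stable f W -> v \in W -> iter k f v \in W.
Proof. by move=> sW vW; elim: k => //= k IH; apply: sW. Qed.

Lemma linear_iter f k : linear (iter k f).
Proof. by move=> a u v; rewrite -!pow_lfunE linearP. Qed.

Lemma iter_lfun0 f k : iter k f 0 = 0.
Proof. by rewrite -pow_lfunE linear0. Qed.

Lemma iter_lfun0_le f k m v : (k <= m)%N -> iter k f v = 0 -> iter m f v = 0.
Proof. by move=> /subnK <- fv0; rewrite iterD fv0 iter_lfun0. Qed.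

(** Dimension bounds the growth: a subspace inside [P] that misses a vector of [P] can be enlarged
    by the line through that vector, and this cannot go on beyond [\dim {:V}]. *)
Lemma vspace_of_pred (P : V -> Prop) :
  P 0 -> (forall a u v, P u -> P v -> P (a *: u + v)) ->
  exists W, forall v, v \in W <-> P v.
Proof.
move=> P0 Plin.
suff H n : (exists W, forall v, v \in W <-> P v) \/
    (exists2 W : {vspace V}, (forall v, v \in W -> P v) & (n <= \dim W)%N).
  have [//|[W _]] := H (\dim {:V}).+1.
  by rewrite leqNgt ltnS dimvS ?subvf.
elim: n => [|n [|[W WP nW]]]; [|by left|].
  by right; exists 0%VS => // v; rewrite memv0 => /eqP ->.
have [WE|/existsNP [v /not_implyP [Pv /negP vW]]] := pselect (forall v, P v -> v \in W).
  by left; exists W => v; split; [exact: WP|exact: WE].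
right; exists (<[v]> + W)%VS.
  move=> w /memv_addP [u /vlineP [a ->] [w' /WP Pw' ->]]; exact: Plin.
apply: leq_ltn_trans nW _; rewrite ltn_neqAle (dimv_leqif_sup (addvSr _ _)).
rewrite subv_add subvv andbT -memvE vW /=.
by rewrite dimvS ?addvSr.
Qed.

Lemma nonincr_stationary (d : nat -> nat) :
  (forall k, d k.+1 <= d k)%N -> exists k, d k.+1 = d k.
Proof.
have [n] := ubnP (d 0%N); elim: n d => // n IH d d0 dle.
have [?|neq] := eqVneq (d 1%N) (d 0%N); first by exists 0%N.
have [|k|k e] := IH (fun k => d k.+1) _ _; last by exists k.+1.
  by rewrite ltnS in d0; apply: leq_trans d0; rewrite ltn_neqAle neq dle.
exact: dle.
Qed.

Lemma stable_limg f W : stable f W -> (f @: W <= W)%VS.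
Proof. by move=> sW; apply/subvP=> _ /memv_imgP [w wW ->]; apply: sW. Qed.

(** Once the images of [W] stop shrinking, [f] is bijective on the last one, which thus meets the
    kernel of every power trivially; dimensions do the rest. The exponent is positive so that [A]
    contains the kernel of [f] on [W], which makes the recursion in [geig_basis] progress. *)
Lemma fitting f W : stable f W -> exists k,
  let A := (W :&: lker (pow_lfun f k.+1))%VS in
  let B := (pow_lfun f k.+1 @: W)%VS in
  [/\ stable f A, stable f B, (A :&: B = 0)%VS & (A + B = W)%VS].
Proof.
move=> sW; pose B k := (pow_lfun f k @: W)%VS.
have BS k : B k.+1 = (f @: B k)%VS by rewrite /B /pow_lfun iterS limg_comp.
have sB k : stable f (B k).
  move=> _ /memv_imgP [w wW ->]; rewrite pow_lfunE -iterS iterSr -pow_lfunE.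
  by apply: memv_img; apply: sW.
have Ble k : (B k.+1 <= B k)%VS by rewrite BS; apply: stable_limg.
have [k Ek] := nonincr_stationary (fun k => dimvS (Ble k.+1)).
exists k; move: k.+1 Ek => {}k Ek A; rewrite -/(B k).
have AB : (A :&: B k = 0)%VS.
  apply/eqP; rewrite -subv0.
  have Bj j : (pow_lfun f j @: B k = B k)%VS.
    elim: j => [|j IH]; first by rewrite /pow_lfun lim1g.
    rewrite /pow_lfun iterS limg_comp -/(pow_lfun f j) IH.
    by apply/eqP; rewrite eqEdim stable_limg //= -BS Ek.
  rewrite /A -capvA; apply: subv_trans (capvSr _ _) _.
  rewrite capvC subv0 -dimv_eq0 -(eqn_add2r (\dim (pow_lfun f k @: B k))).
  by rewrite limg_ker_dim Bj.
split.
- move=> v; rewrite !memv_cap !memv_ker !pow_lfunE => /andP [/sW -> /eqP vk].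
  by rewrite -iterSr iterS vk linear0 eqxx.
- exact: sB.
- by [].
- apply/eqP; rewrite eqEdim subv_add capvSl /=; apply/andP; split.
    apply/subvP=> _ /memv_imgP [w wW ->]; rewrite pow_lfunE; exact: stable_iter.
  by rewrite dimv_disjoint_sum // limg_ker_dim.
Qed.

End LinearAlgebra.

Section GeneralizedEigenvectors.
Variables (K : fieldType) (V : vectType K).
Implicit Types (f T : 'End(V)) (W A B : {vspace V}) (v w : V) (a b : K).

Definition shift T a : 'End(V) := T - a *: \1%VF.

Definition geig T a v := exists k, iter k (shift T a) v = 0.

Lemma shiftE T a v : shift T a v = T v - a *: v.
Proof. by rewrite /shift add_lfunE opp_lfunE scale_lfunE id_lfunE. Qed.

Lemma geig0 T a : geig T a 0.
Proof. by exists 0%N. Qed.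

Lemma geigP T a c v w : geig T a v -> geig T a w -> geig T a (c *: v + w).
Proof.
move=> [k vk] [m wm]; exists (k + m)%N; rewrite linear_iter.
by rewrite (iter_lfun0_le (leq_addr m k) vk) (iter_lfun0_le (leq_addl k m) wm)
  scaler0 addr0.
Qed.

Lemma geigZ T a c v : geig T a v -> geig T a (c *: v).
Proof. by move=> gv; rewrite -[c *: v]addr0; apply: geigP => //; apply: geig0. Qed.

Lemma geigD T a v w : geig T a v -> geig T a w -> geig T a (v + w).
Proof. by move=> gv gw; rewrite -[v]scale1r; apply: geigP. Qed.

Lemma eigen_geig T a v : T v = a *: v -> geig T a v.
Proof. by move=> Tv; exists 1%N; rewrite /= shiftE Tv subrr. Qed.

Lemma geig_comm f T a v :
  (forall w, f (T w) = T (f w)) -> geig T a v -> geig T a (f v).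
Proof.
move=> fT [k vk]; exists k; rewrite -[RHS](linear0 f) -vk.
elim: k {vk} => //= k ->; by rewrite !shiftE lfunB lfunZ fT.
Qed.

Lemma shift_comm T a b v : shift T a (shift T b v) = shift T b (shift T a v).
Proof.
rewrite !shiftE !lfunB !lfunZ !scalerBr !scalerA [b * a]mulrC !opprB.
by rewrite -!addrA; congr (_ + _); rewrite addrCA [RHS]addrCA [- _ - _]addrC.
Qed.

Lemma geig_shift T a b v : geig T a v -> geig T a (shift T b v).
Proof.
apply: geig_comm => w; rewrite !shiftE lfunB lfunZ; congr (_ - _).
Qed.

Lemma geig_iter_shift T a b k v :
  geig T a v -> geig T a (iter k (shift T b) v).
Proof. by move=> gv; elim: k => //= k; apply: geig_shift. Qed.

(** Induction on [k] reduces to an eigenvector for [b], which the shift by [a] multiplies by the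
    nonzero scalar [b - a]; no power of that shift can kill it. *)
Lemma geig_inj T a b k v :
  b != a -> geig T a v -> iter k (shift T b) v = 0 -> v = 0.
Proof.
move=> ba gv; elim: k => //= k IH vk; apply: IH.
have := geig_iter_shift b k gv; move: vk; move: (iter k _ v) => w.
rewrite shiftE => /eqP; rewrite subr_eq0 => /eqP Tw [m].
have -> : iter m (shift T a) w = (b - a) ^+ m *: w.
  elim: m => [|m /= ->]; first by rewrite expr0 scale1r.
  by rewrite lfunZ shiftE Tw -scalerBl scalerA exprSr.
by move/eqP; rewrite scaler_eq0 expf_eq0 subr_eq0 (negPf ba) andbF => /eqP.
Qed.

End GeneralizedEigenvectors.

Section ClosedField.
Variables (K : closedFieldType) (V : vectType K).
Implicit Types (f T : 'End(V)) (W A B : {vspace V}) (v w : V) (a b : K).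

(** Cayley-Hamilton for a split characteristic polynomial. Keeping the product as a list of shifts
    lets later arguments peel off one linear factor at a time. *)
Lemma foldr_mulmx_shift_eq0 n (A : 'M[K]_n) :
  exists zs : seq K, forall u : 'rV_n, foldr (fun z u => u *m A - z *: u) u zs = 0.
Proof.
case: n A => [|n] A; first by exists [::] => u; rewrite thinmx0.
have [zs] := closed_field_poly_normal (char_poly A).
rewrite (monicP (char_poly_monic _)) scale1r => zsE; exists zs => u.
rewrite -[RHS](mulmx0 _ u) -(Cayley_Hamilton A) {}zsE.
elim: zs => [|z zs IH] /=; first by rewrite big_nil rmorph1 mulmx1.
rewrite big_cons mulrC rmorphM /= -mulmxE mulmxA -IH rmorphB /= horner_mx_X.
by rewrite horner_mx_C mulmxBr mul_mx_scalar.
Qed.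

Lemma foldr_shift_eq0 T :
  exists zs : seq K, forall v, foldr (fun z => shift T z) v zs = 0.
Proof.
have eP := vbasisP {:V}; set e := vbasis {:V} in eP.
have [zs zs0] := foldr_mulmx_shift_eq0 (mxof e e T).
exists zs => v; apply/eqP; rewrite -(rVof_eq0 eP); apply/eqP.
rewrite -(zs0 (rVof e v)); elim: zs {zs0} => //= z zs <-.
by rewrite shiftE linearB linearZ /= mul_mxof rVofK.
Qed.

(** Apply the annihilating shifts one after another to a nonzero vector of [W]: the last nonzero
    result is an eigenvector. *)
Lemma eigenvector_stable T W : stable T W -> W != 0%VS ->
  exists a v, [/\ v \in W, v != 0 & T v = a *: v].
Proof.
move=> sW; rewrite -vpick0 => v0.
have [zs /(_ (vpick W))] := foldr_shift_eq0 T.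
elim: zs => /= [/eqP|z zs IH]; first by rewrite (negPf v0).
set w := foldr _ _ zs in IH *; have [//|w0 Tw] := eqVneq w 0; first by move=> /IH.
exists z, w; split => //; last by apply/eqP; rewrite -subr_eq0 -shiftE Tw.
rewrite /w; elim: (zs) => [|y ys IHs] /=; first exact: memv_pick.
by rewrite shiftE memvB ?memvZ ?sW.
Qed.

Lemma shift_stable T a W : stable T W <-> stable (shift T a) W.
Proof.
split=> sW v vW; first by rewrite shiftE memvB ?memvZ ?sW.
by rewrite -[T v](subrK (a *: v)) -shiftE memvD ?memvZ ?sW.
Qed.

Lemma geig_basis T W : stable T W ->
  exists2 X, basis_of W X & forall x, x \in X -> exists a, geig T a x.
Proof.
have [n] := ubnP (\dim W); elim: n W => // n IH W; rewrite ltnS => dW sW.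
have [->|W0] := eqVneq W 0%VS; first by exists [::]; rewrite ?nil_basis.
have [a [v [vW v0 Tv]]] := eigenvector_stable sW W0.
have [k] := fitting ((shift_stable T a W).1 sW).
set A := (_ :&: _)%VS; set B := (_ @: _)%VS => /= -[sA sB AB WE].
have vA : v \in A.
  rewrite memv_cap vW memv_ker pow_lfunE iterSr shiftE Tv subrr.
  by rewrite iter_lfun0 eqxx.
have [||X XB Xg] := IH B.
- apply: leq_trans dW; rewrite -WE dimv_disjoint_sum // -addn1 addnC leq_add2r.
  rewrite lt0n dimv_eq0; apply: contraNneq v0 => A0.
  by rewrite -memv0 -A0.
- exact/(shift_stable T a).
exists (vbasis A ++ X).
  rewrite -WE; apply: cat_basis => //; [exact/directv_addP|exact: vbasisP].
move=> x; rewrite mem_cat => /orP [/vbasis_mem|/Xg //].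
rewrite memv_cap memv_ker pow_lfunE => /andP [_ /eqP xk].
by exists a, k.+1.
Qed.

End ClosedField.

Section Trace.
Variables (K : fieldType) (V : vectType K).
Implicit Types (f g : 'End(V)).

Lemma lfun_trace_is_linear : linear (@lfun_trace K V : 'End(V) -> K^o).
Proof. by move=> a f g; rewrite /lfun_trace linearP /= mxtraceD mxtraceZ. Qed.

Lemma lfun_trace0 : lfun_trace (0 : 'End(V)) = 0.
Proof. by rewrite /lfun_trace linear0 mxtrace0. Qed.

Lemma lfun_traceD f g : lfun_trace (f + g) = lfun_trace f + lfun_trace g.
Proof. by have := lfun_trace_is_linear 1 f g; rewrite !scale1r. Qed.

Lemma lfun_traceN f : lfun_trace (- f) = - lfun_trace f.
Proof. by rewrite /lfun_trace linearN /= raddfN. Qed.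

Lemma lfun_traceB f g : lfun_trace (f - g) = lfun_trace f - lfun_trace g.
Proof. by rewrite lfun_traceD lfun_traceN. Qed.

Lemma lfun_traceC f g : lfun_trace (f \o g)%VF = lfun_trace (g \o f)%VF.
Proof.
by rewrite /lfun_trace !(mxof_comp _ _ (vbasisP {:V})) mxtrace_mulC.
Qed.

Lemma lfun_trace_mxof (X : (\dim {:V}).-tuple V) f :
  basis_of {:V} X -> lfun_trace f = \tr (mxof X X f).
Proof.
move=> XP; have eP := vbasisP {:V}; rewrite /lfun_trace.
rewrite -{1}[f]comp_lfun1r (mxof_comp _ _ XP).
rewrite mxtrace_mulC -(mxof_comp _ _ eP).
by rewrite comp_lfun1l.
Qed.

Definition lfun_nilpotent f := forall v, exists k, iter k f v = 0.

Lemma shift0 f : shift f 0 = f.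
Proof. by rewrite /shift scale0r subr0. Qed.

Lemma lfun_nilpotent_geig f v : lfun_nilpotent f -> geig f 0 v.
Proof. by move=> /(_ v) [k vk]; exists k; rewrite shift0. Qed.

End Trace.

(** All roots of the characteristic polynomial are eigenvalues, hence zero, so it is a power of the
    variable and its subleading coefficient vanishes. *)
Lemma lfun_trace_nilpotent (K : closedFieldType) (V : vectType K) (f : 'End(V)) :
  lfun_nilpotent f -> lfun_trace f = 0.
Proof.
move=> fN; have eP := vbasisP {:V}; rewrite /lfun_trace.
set A := mxof _ _ f.
have [n0|n0] := posnP (\dim {:V}).
  by rewrite /mxtrace big1 // => i; have := ltn_ord i; rewrite {2}n0.
apply/eqP; rewrite -oppr_eq0 -char_poly_trace //.
have [zs zsE] := closed_field_poly_normal (char_poly A).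
move: zsE; rewrite (monicP (char_poly_monic _)) scale1r => zsE.
have : all (pred1 0) zs.
  apply/allP=> z; rewrite -root_prod_XsubC -zsE -eigenvalue_root_char.
  move=> /eigenvalueP [u uA u0] /=.
  have [k] := fN (vecof (vbasis {:V}) u).
  have -> : iter k f (vecof (vbasis {:V}) u) = z ^+ k *: vecof (vbasis {:V}) u.
    elim: k => [|k /= ->]; first by rewrite scale1r.
    by rewrite lfunZ (hom_vecof _ eP) uA linearZ /= scalerA exprSr.
  move/eqP; rewrite scaler_eq0 expf_eq0 vecof_eq0 // (negPf u0) orbF.
  by case/andP.
move/all_pred1P=> zs0; move: zsE; rewrite zs0 big_nseq iter_mulr_1 subr0.
move=> cE; have := size_char_poly A; rewrite cE size_polyXn => -[->].
by rewrite coefXn; case: (\dim _) n0 => // m _ /=; rewrite eqn_leq ltnn andbF.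
Qed.

Section Spectral.
Variables (K : closedFieldType) (V : vectType K).
Implicit Types (T f : 'End(V)) (W : {vspace V}) (v w : V) (phi : K -> K).

Lemma geig_ind T W (P : V -> Prop) :
  stable T W -> P 0 -> (forall v w, P v -> P w -> P (v + w)) ->
  (forall a v, v \in W -> geig T a v -> P v) -> forall v, v \in W -> P v.
Proof.
move=> sW P0 PD Pg v; have [X XW Xg] := geig_basis sW.
rewrite -(span_basis XW) -[X]in_tupleE => /coord_span ->.
apply: (big_ind P) => // i _.
have Xi : X`_i \in X by rewrite mem_nth.
have [a ga] := Xg _ Xi; apply: (Pg a); last exact: geigZ.
by rewrite memvZ // (basis_mem XW).
Qed.

Lemma geig_full_ind T (P : V -> Prop) :
  P 0 -> (forall v w, P v -> P w -> P (v + w)) ->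
  (forall a v, geig T a v -> P v) -> forall v, P v.
Proof.
move=> P0 PD Pg v; apply: (@geig_ind T {:V}%VS P) => //; last exact: memvf.
  by move=> ? _; apply: memvf.
by move=> a w _; apply: Pg.
Qed.

Lemma geig_full_basis T :
  {Xl : (\dim {:V}).-tuple V * ('I_(\dim {:V}) -> K) |
    basis_of {:V} Xl.1 /\ forall i, geig T (Xl.2 i) Xl.1`_i}.
Proof.
apply: cid; have [|X XP Xg] := @geig_basis K V T {:V}%VS.
  by move=> v _; apply: memvf.
have sX : size X == \dim {:V} by rewrite (@size_basis _ _ _ _ (in_tuple X) XP).
have /choice [lam lamP] : forall i : 'I_(\dim {:V}), exists a, geig T a (Tuple sX)`_i.
  by move=> i; apply: Xg; rewrite mem_nth //= (eqP sX).
by exists (Tuple sX, lam).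
Qed.

Definition spec_basis T := (sval (geig_full_basis T)).1.
Definition spec_value T := (sval (geig_full_basis T)).2.

Lemma spec_basisP T : basis_of {:V} (spec_basis T).
Proof. exact: (svalP (geig_full_basis T)).1. Qed.

Lemma spec_valueP T (i : 'I_(\dim {:V})) : geig T (spec_value T i) (spec_basis T)`_i.
Proof. exact: (svalP (geig_full_basis T)).2. Qed.

(** The basis is an arbitrary choice; [spectral_geig] shows that the operator does not depend on
    it. *)
Definition spectral T phi : 'End(V) :=
  hommx (spec_basis T) (spec_basis T) (diag_mx (\row_i phi (spec_value T i))).

Lemma spectral_basis T phi (i : 'I_(\dim {:V})) :
  spectral T phi (spec_basis T)`_i = phi (spec_value T i) *: (spec_basis T)`_i.
Proof.
have XP := spec_basisP T.
rewrite /spectral hommxE // rVofE // -rowE row_diag_mx.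
by rewrite linearZ /= vecof_delta mxE.
Qed.

Lemma lfun_trace_spectral T phi :
  lfun_trace (spectral T phi) = \sum_i phi (spec_value T i).
Proof.
have XP := spec_basisP T.
rewrite (lfun_trace_mxof _ XP) /spectral hommxK // mxtrace_diag.
by apply: eq_bigr => i _; rewrite mxE.
Qed.

(* The basis vectors in the expansion of [v] whose eigenvalue is not [a] sum to
   a vector on which all shifts [T - b] with [b != a] are injective, but which a
   product of such shifts annihilates. *)
Lemma spectral_geig T phi a v : geig T a v -> spectral T phi v = phi a *: v.
Proof.
move=> gv; have XP := spec_basisP T; set X := spec_basis T in XP *.
pose c i := coord X i v; have vE : v = \sum_i c i *: X`_i.
  by apply: (coord_basis XP); apply: memvf.
pose P i := spec_value T i == a.
have wgeig : geig T a (\sum_(i | ~~ P i) c i *: X`_i).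
  have -> : \sum_(i | ~~ P i) c i *: X`_i = (-1) *: \sum_(i | P i) c i *: X`_i + v.
    by rewrite {1}vE [X in _ + X](bigID P) /= scaleN1r addKr.
  apply: geigP => //; apply: (big_ind (geig T a)).
  - exact: geig0.
  - exact: geigD.
  by move=> i /eqP <-; apply/geigZ/spec_valueP.
have w0 : \sum_(i | ~~ P i) c i *: X`_i = 0.
  pose F := foldr (fun z => shift T z).
  have FD zs u w : F (u + w) zs = F u zs + F w zs.
    by elim: zs => //= z zs ->; rewrite lfunD.
  have F0 zs : F 0 zs = 0 by elim: zs => //= z zs ->; rewrite lfun0.
  have Fs z zs u : F (shift T z u) zs = shift T z (F u zs).
    by elim: zs => //= y zs ->; rewrite shift_comm.
  have FC zs ys u : F (F u ys) zs = F (F u zs) ys.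
    by elim: zs => //= z zs ->; rewrite Fs.
  pose Q w := exists2 zs, a \notin zs & F w zs = 0.
  have [zs azs Fw] : Q (\sum_(i | ~~ P i) c i *: X`_i).
    apply: (big_ind Q); first by exists [::].
      move=> u w [zs azs Fu] [ys ays Fw]; exists (zs ++ ys).
        by rewrite mem_cat negb_or azs.
      by rewrite FD /F !foldr_cat -/F Fw F0 addr0 FC Fu F0.
    move=> i nPi; have [k Xk] := geigZ (c i) (spec_valueP T i).
    exists (nseq k (spec_value T i)).
      by rewrite mem_nseq negb_and [a == _]eq_sym nPi orbT.
    by rewrite -[RHS]Xk; elim: k {Xk} => //= k ->.
  move: wgeig Fw azs; move: (\sum_(i | _) _) => w gw.
  elim: zs => //= z zs IH Fz; rewrite inE negb_or eq_sym => /andP [za /IH]; apply.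
  apply: (geig_inj (k := 1) za _ Fz).
  by elim: (zs) => //= y ys; apply: geig_shift.
rewrite {1}vE lfun_sum (bigID P) /= [X in _ + X]big1 ?addr0; last first.
  move=> i nPi; suff -> : c i = 0 by rewrite scale0r lfun0.
  have <- : coord X i (\sum_(i | ~~ P i) c i *: X`_i) = c i.
    rewrite big_mkcond /= (eq_bigr (fun i => (if ~~ P i then c i else 0) *: X`_i)).
      by rewrite coord_sum_free ?nPi // (basis_free XP).
    by move=> j _; case: ifP => // _; rewrite scale0r.
  by rewrite w0 linear0.
rewrite [in RHS]vE [in RHS](bigID P) /= w0 addr0 scaler_sumr; apply: eq_bigr => i /eqP Pi.
by rewrite lfunZ spectral_basis Pi !scalerA mulrC.
Qed.

Lemma spectral_stable T phi W : stable T W -> stable (spectral T phi) W.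
Proof.
move=> sW; apply: (geig_ind sW).
- by rewrite lfun0 mem0v.
- by move=> v w vW wW; rewrite lfunD memvD.
by move=> a v vW gv; rewrite (spectral_geig phi gv) memvZ.
Qed.

Lemma spectral_comm T phi f :
  (forall a v, geig T a v -> geig T a (f v)) ->
  forall v, f (spectral T phi v) = spectral T phi (f v).
Proof.
move=> fg; apply: (geig_full_ind (T := T)) => [|v w fv fw|a v gv].
- by rewrite !lfun0.
- by rewrite !lfunD fv fw.
by rewrite (spectral_geig phi gv) (spectral_geig phi (fg _ _ gv)) lfunZ.
Qed.

Lemma lfun_nilpotent_full f T :
  (forall a v, geig T a v -> exists k, iter k f v = 0) -> lfun_nilpotent f.
Proof.
move=> fN; apply: (geig_full_ind (T := T)) => //; first by exists 0%N.
move=> v w [k vk] [m wm]; exists (k + m)%N; rewrite -pow_lfunE lfunD !pow_lfunE.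
by rewrite (iter_lfun0_le (leq_addr m k) vk) (iter_lfun0_le (leq_addl k m) wm) addr0.
Qed.

(** On the generalized eigenspace of [a], the two operators [T \o spectral T phi] and
    [spectral T (fun a => a * phi a)] differ by [phi a] times the shift of [T], so their difference
    is nilpotent and has trace zero. *)
Lemma lfun_trace_comp_spectral T phi :
  lfun_trace (T \o spectral T phi)%VF =
  \sum_i spec_value T i * phi (spec_value T i).
Proof.
pose N := (T \o spectral T phi)%VF - spectral T (fun a => a * phi a).
have N0 : lfun_trace N = 0.
  apply/lfun_trace_nilpotent/(@lfun_nilpotent_full _ T) => a v gv.
  have NE w : geig T a w -> N w = phi a *: shift T a w.
    move=> gw; rewrite /N add_lfunE opp_lfunE comp_lfunE !(spectral_geig _ gw).
    by rewrite lfunZ shiftE scalerBr scalerA mulrC.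
  have [k vk] := gv; exists k.
  suff -> : iter k N v = phi a ^+ k *: iter k (shift T a) v by rewrite vk scaler0.
  elim: k {vk} => [|k /= ->]; first by rewrite scale1r.
  rewrite NE; last exact/geigZ/geig_iter_shift.
  by rewrite lfunZ scalerA exprS.
have -> : (T \o spectral T phi)%VF = N + spectral T (fun a => a * phi a).
  by rewrite subrK.
by rewrite lfun_traceD N0 add0r lfun_trace_spectral.
Qed.

End Spectral.

(* The trace is the sum of the squared moduli of the eigenvalues. *)
Lemma lfun_trace_conj_nilpotent (K : numClosedFieldType) (V : vectType K)
    (T : 'End(V)) :
  lfun_trace (T \o spectral T Num.conj)%VF = 0 -> lfun_nilpotent T.
Proof.
rewrite lfun_trace_comp_spectral => T0.
have lam0 i : spec_value T i = 0.
  apply/eqP; rewrite -normr_eq0 -sqrf_eq0 normCK.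
  apply/eqP/(psumr_eq0P _ T0) => // j _.
  by rewrite -normCK exprn_ge0.
move=> v; suff: geig T 0 v by rewrite /geig shift0.
rewrite (coord_basis (spec_basisP T) (memvf v)).
apply: (big_ind (geig T 0)); [exact: geig0|exact: geigD|move=> i _].
by apply: geigZ; rewrite -(lam0 i); apply: spec_valueP.
Qed.

(** * Engel's theorem, Cartan's criterion and simple ideals *)

Section LieBasics.
Variables (K : fieldType) (g : lieAlgType K).
Implicit Types (x y z v w : g) (c : K) (A B C L M W X : {vspace g}).

HB.instance Definition _ x := GRing.isSemilinear.Build K g g _ (lie x)
  (GRing.semilinear_linear (fun a y z => @lie_linearr K g a y z x)).

Lemma lieDl x y z : lie (x + y) z = lie x z + lie y z.
Proof. by rewrite -{1}[x]scale1r lie_linearl scale1r. Qed.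

Lemma lie0l z : lie 0 z = 0.
Proof. by apply: (addrI (lie 0 z)); rewrite -lieDl !addr0. Qed.

Lemma lieZl (a : K) x z : lie (a *: x) z = a *: lie x z.
Proof. by rewrite -[a *: x]addr0 lie_linearl lie0l addr0. Qed.

Lemma lieNl x z : lie (- x) z = - lie x z.
Proof. by rewrite -scaleN1r lieZl scaleN1r. Qed.

Lemma lieBl x y z : lie (x - y) z = lie x z - lie y z.
Proof. by rewrite lieDl lieNl. Qed.

Lemma lieDr x y z : lie z (x + y) = lie z x + lie z y.
Proof. exact: linearD. Qed.

Lemma lie0r z : lie z 0 = 0.
Proof. exact: linear0. Qed.

Lemma lieZr (a : K) x z : lie z (a *: x) = a *: lie z x.
Proof. exact: linearZ. Qed.

Lemma lieNr x z : lie z (- x) = - lie z x.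
Proof. exact: linearN. Qed.

Lemma lieBr x y z : lie z (x - y) = lie z x - lie z y.
Proof. exact: linearB. Qed.

Lemma lie_sumr I (r : seq I) (P : pred I) (F : I -> g) x :
  lie x (\sum_(i <- r | P i) F i) = \sum_(i <- r | P i) lie x (F i).
Proof. exact: linear_sum. Qed.

Lemma lieC x y : lie x y = - lie y x.
Proof.
apply/eqP; rewrite -addr_eq0; apply/eqP; have := lie_alt (x + y).
by rewrite lieDl !lieDr !lie_alt add0r addr0.
Qed.

Lemma lie_suml I (r : seq I) (P : pred I) (F : I -> g) x :
  lie (\sum_(i <- r | P i) F i) x = \sum_(i <- r | P i) lie (F i) x.
Proof. by rewrite lieC lie_sumr -sumrN; apply: eq_bigr => i _; rewrite -lieC. Qed.

Lemma lie_deriv x y z : lie x (lie y z) = lie (lie x y) z + lie y (lie x z).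
Proof.
apply/eqP; rewrite -subr_eq0 opprD addrA; apply/eqP.
rewrite -(lie_jacobi x y z) [lie (lie x y) z]lieC opprK [lie x z]lieC lieNr opprK.
by rewrite addrAC.
Qed.

Lemma adE x y : ad x y = lie x y.
Proof. exact: lfunE. Qed.

Lemma ad_is_linear : linear (@ad K g).
Proof.
by move=> a x y; apply/lfunP=> z; rewrite add_lfunE scale_lfunE !adE lie_linearl.
Qed.

HB.instance Definition _ := GRing.isSemilinear.Build K g 'End(g) _ (@ad K g)
  (GRing.semilinear_linear ad_is_linear).

Lemma ad_lie x y : ad (lie x y) = ((ad x \o ad y) - (ad y \o ad x))%VF.
Proof.
apply/lfunP=> z; rewrite add_lfunE opp_lfunE !comp_lfunE !adE.
by rewrite lie_deriv addrK.
Qed.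

Lemma lie_span_mem A B a b : a \in A -> b \in B -> lie a b \in lie_span A B.
Proof.
move=> aA bB; rewrite (coord_vbasis aA) (coord_vbasis bB).
rewrite lie_suml rpred_sum // => i _; rewrite lieZl memvZ //.
rewrite lie_sumr rpred_sum // => j _; rewrite lieZr memvZ // memv_span //.
by apply/allpairsP; exists ((vbasis A)`_i, (vbasis B)`_j); rewrite /= !mem_nth ?size_tuple.
Qed.

Lemma lie_span_subP A B C :
  (forall a b, a \in A -> b \in B -> lie a b \in C) -> (lie_span A B <= C)%VS.
Proof.
move=> AB; apply/span_subvP => _ /allpairsP [[a b] /= [aA bB ->]].
by apply: AB; apply: vbasis_mem.
Qed.

Lemma lie_spanS A B A' B' :
  (A <= A')%VS -> (B <= B')%VS -> (lie_span A B <= lie_span A' B')%VS.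
Proof.
move=> /subvP sA /subvP sB; apply: lie_span_subP => a b aA bB.
by apply: lie_span_mem; [exact: sA|exact: sB].
Qed.

Lemma iter_lie_spanS k A B B' : (B <= B')%VS ->
  (iter k (lie_span A) B <= iter k (lie_span A) B')%VS.
Proof. by move=> sB; elim: k => //= k; apply: lie_spanS. Qed.

Lemma iter_ad k x v : iter k (ad x) v = iter k (lie x) v.
Proof. by elim: k => //= k ->; rewrite adE. Qed.

Lemma nilpotent_uniform (f : 'End(g)) W :
  (forall w, w \in W -> exists k, iter k f w = 0) ->
  exists k, (pow_lfun f k @: W = 0)%VS.
Proof.
move=> fN; have [k Xk] : exists k, forall x, x \in (vbasis W : seq g) -> iter k f x = 0.
  have: forall x, x \in (vbasis W : seq g) -> exists k, iter k f x = 0.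
    by move=> x /vbasis_mem /fN.
  elim: (vbasis W : seq g) => [|x s IH] XN; first by exists 0%N.
  have [|k kX] := IH; first by move=> y yX; apply: XN; rewrite inE yX orbT.
  have [|m xm] := XN x; first by rewrite inE eqxx.
  exists (m + k)%N => y; rewrite inE => /predU1P [->|/kX].
    exact: iter_lfun0_le (leq_addr _ _) xm.
  exact: iter_lfun0_le (leq_addl _ _).
exists k; apply/eqP; rewrite -lkerE -{1}(span_basis (vbasisP W)).
by apply/span_subvP => x /Xk xk; rewrite memv_ker pow_lfunE xk.
Qed.

(* [M] is an ideal of [M + <v>], so every term [D i] of the descending chain of
   [M] on [W] is stable under [v]; on it [M + <v>] acts as [v] modulo [D i.+1]. *)
Lemma engel_step M W v :
  lie_subalgebra M -> (forall m w, m \in M -> w \in W -> lie m w \in W) ->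
  (forall w, w \in W -> lie v w \in W) ->
  (forall m, m \in M -> lie v m \in M) ->
  (forall w, w \in W -> exists k, iter k (lie v) w = 0) ->
  (exists k, iter k (lie_span M) W = 0%VS) ->
  exists k, iter k (lie_span (M + <[v]>)) W = 0%VS.
Proof.
move=> sM MW vW vM vN [k Dk]; pose D i := iter i (lie_span M) W.
have DW i : (D i <= W)%VS.
  elim: i => //= i /subvP IH; apply: lie_span_subP => m d mM /IH; exact: MW.
have Dle i : (D i.+1 <= D i)%VS.
  elim: i => [|i IH]; first exact: DW 1%N.
  by rewrite /D iterS [X in (_ <= X)%VS]iterS; apply: lie_spanS.
have vD i d : d \in D i -> lie v d \in D i.
  elim: i d => [|i IH] d; first exact: vW.
  rewrite -adE memv_preim; apply/subvP: d; apply: lie_span_subP => m d mM dD.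
  rewrite -memv_preim adE lie_deriv memvD //.
    by apply: lie_span_mem => //; apply: vM.
  by apply: lie_span_mem => //; apply: IH.
have [j vj] : exists j, (pow_lfun (ad v) j @: W = 0)%VS.
  by apply: nilpotent_uniform => w /vN [n wn]; exists n; rewrite iter_ad.
have step i l : (iter l (lie_span (M + <[v]>)) (D i) <=
                 D i.+1 + pow_lfun (ad v) l @: D i)%VS.
  elim: l => [|l IH]; first by rewrite /pow_lfun /= lim1g addvSr.
  apply: subv_trans (lie_spanS (subvv _) IH) _.
  apply: lie_span_subP => x y /memv_addP [m mM [_ /vlineP [c ->] ->]].
  move=> /memv_addP [d dD [_ /memv_imgP [w wD ->] ->]].
  have wD' : pow_lfun (ad v) l w \in D i.
    rewrite pow_lfunE iter_ad; elim: (l) => //= n; exact: vD.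
  set u := pow_lfun _ l w in wD' *.
  have -> : lie (m + c *: v) (d + u) =
      (lie m (d + u) + c *: lie v d) + c *: lie v u.
    by rewrite lieDl lieZl (lieDr d u v) scalerDr addrA.
  apply: memv_add.
    rewrite memvD ?memvZ ?vD // /D iterS lie_span_mem // memvD //.
    exact: (subvP (Dle i)).
  apply: memvZ; have -> : lie v u = pow_lfun (ad v) l.+1 w.
    by rewrite /u !pow_lfunE /= adE.
  exact: memv_img.
have [m Dm] : exists m, (iter m (lie_span (M + <[v]>)) W <= D k)%VS.
  elim: k {Dk} => [|i [m IH]]; first by exists 0%N.
  exists (j + m)%N; rewrite iterD.
  apply: subv_trans (iter_lie_spanS _ _ IH) _.
  apply: subv_trans (step i j) _; rewrite subv_add subvv /=.
  apply: subv_trans (limgS _ (DW i)) _; by rewrite vj sub0v.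
by exists m; apply/eqP; rewrite -subv0 -Dk.
Qed.

(** Some term of the chain is not contained in [X] while its successor is; [v] is taken there. In
    both uses [X] is the acting subalgebra [M], so [v] normalizes it without belonging to it. *)
Lemma lie_span_escape k M L X :
  (iter k (lie_span M) L <= X)%VS -> ~~ (L <= X)%VS ->
  exists i v, [/\ v \in iter i (lie_span M) L, v \notin X &
    forall m, m \in M -> lie m v \in X].
Proof.
move=> Ek /subvPn [v]; elim: k Ek v => [|k IH] Ek v vL vX.
  by case/negP: vX; apply: (subvP Ek).
have [/IH Ek'|/subvPn [u uE uX]] := boolP (iter k (lie_span M) L <= X)%VS.
  exact: Ek' vX.
exists k, u; split=> // m mM; apply: (subvP Ek); exact: lie_span_mem.
Qed.

(** A proper subalgebra [M] of [L] that already acts nilpotently on [W] can be enlarged: as [L] lies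
    in [W], the chain of [M] on [L] also reaches zero, so it yields a vector outside [M] normalizing
    [M], which [engel_step] adjoins. The space [W] is separate from [L] because a Cartan subalgebra
    will act on a larger space. *)
Lemma engel L W :
  lie_subalgebra L -> (L <= W)%VS ->
  (forall x w, x \in L -> w \in W -> lie x w \in W) ->
  (forall x w, x \in L -> w \in W -> exists k, iter k (lie x) w = 0) ->
  exists k, iter k (lie_span L) W = 0%VS.
Proof.
move=> sL LW LWW LN.
pose P M := [/\ lie_subalgebra M, (M <= L)%VS &
  exists k, iter k (lie_span M) W = 0%VS].
suff H n : exists2 M, P M & M = L \/ (n <= \dim M)%N.
  have [M [sM ML MN] [<- //|]] := H (\dim L).+1.
  by rewrite ltnNge dimvS.
elim: n => [|n [M PM [eML|nM]]].
- exists 0%VS; last by right.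
  split; [|exact: sub0v|exists 1%N].
    by move=> x y; rewrite !memv0 => /eqP -> _; rewrite lie0l.
  apply/eqP; rewrite -subv0 /=; apply: lie_span_subP => x y.
  by rewrite !memv0 => /eqP ->; rewrite lie0l.
- by exists M => //; left.
have [sM ML [k Mk]] := PM.
have [eML|neq] := eqVneq M L; first by exists M => //; left.
have LM : ~~ (L <= M)%VS by apply: contraNN neq; rewrite eqEsubv ML.
pose E i := iter i (lie_span M) L.
have Ek : (E k <= M)%VS.
  by apply: subv_trans (iter_lie_spanS k M LW) _; rewrite Mk sub0v.
have EL i : (E i <= L)%VS.
  elim: i => //= i /subvP IH; apply: lie_span_subP => m d mM /IH dL.
  by apply: sL => //; apply: (subvP ML).
have [i [v [vE vM Mv]]] := lie_span_escape Ek LM.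
have vL : v \in L by apply: (subvP (EL i)).
have vMM m : m \in M -> lie v m \in M.
  by move=> mM; rewrite lieC memvN Mv.
exists (M + <[v]>)%VS.
  split.
  - move=> x y /memv_addP [m mM [_ /vlineP [a ->] ->]].
    move=> /memv_addP [m' m'M [_ /vlineP [b ->] ->]].
    apply: (subvP (addvSl M <[v]>)).
    rewrite lieDl !lieDr !lieZl !lieZr lie_alt !scaler0 addr0 [lie m v]lieC.
    by rewrite !memvD ?memvZ ?memvN ?vMM //; apply: sM.
  - by rewrite subv_add ML -memvE.
  apply: engel_step => //; last by exists k.
  - by move=> m w /(subvP ML); apply: LWW.
  - by move=> w; apply: LWW.
  - by move=> w; apply: LN.
right; apply: leq_ltn_trans nM _.
rewrite ltn_neqAle (dimv_leqif_sup (addvSl _ _)) subv_add subvv /= -memvE vM.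
by rewrite dimvS // addvSl.
Qed.

End LieBasics.

Lemma lfun_of_linear (K : fieldType) (V W : vectType K) (f : V -> W) :
  linear f -> exists F : 'Hom(V, W), F =1 f.
Proof.
move=> lf; pose fl : {linear V -> W} := HB.pack f (GRing.isLinear.Build K V W _ f lf).
by exists (linfun fl) => x; rewrite lfunE.
Qed.

(** [J] is the kernel of the map [F] that pairs a vector with a basis of [I]. If [I] meets [J]
    trivially, [F] is injective on [I], hence maps [I] onto the whole target by dimension, and every
    vector can be corrected by one of [I] to lie in [J]. *)
Lemma orthogonal_complement (K : fieldType) (V : vectType K) (b : V -> V -> K)
    (I : {vspace V}) :
  (forall x, linear (b x : V -> K^o)) ->
  (forall c x y z, b (c *: x + y) z = c * b x z + b y z) ->
  exists J : {vspace V}, (forall z, z \in J <-> forall x, x \in I -> b x z = 0) /\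
    ((I :&: J = 0)%VS -> (I + J = {:V})%VS).
Proof.
move=> blr bll.
have [F FE] : exists F : 'Hom(V, 'rV[K]_(\dim I)), F =1 fun z => \row_i b (vbasis I)`_i z.
  apply: lfun_of_linear => c u v; apply/rowP => i; rewrite !mxE.
  by rewrite (blr _ c u v).
have FJ z : z \in lker F <-> forall x, x \in I -> b x z = 0.
  rewrite memv_ker FE; split=> [/eqP/rowP Fz x xI|bz]; last first.
    apply/eqP/rowP => i; rewrite !mxE bz // vbasis_mem //.
    by rewrite mem_nth ?size_tuple.
  rewrite (coord_vbasis xI); apply: (big_ind (fun x => b x z = 0)).
  - by have := bll (-1) 0 0 z; rewrite scaler0 addr0 mulN1r addNr.
  - by move=> u v bu bv; have := bll 1 u v z; rewrite scale1r bu bv mulr0 addr0.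
  move=> i _; have := Fz i; rewrite !mxE => bi.
  have b0 : b 0 z = 0 by have := bll (-1) 0 0 z; rewrite scaler0 addr0 mulN1r addNr.
  by have := bll (coord (vbasis I) i x) (vbasis I)`_i 0 z; rewrite addr0 bi b0 mulr0 addr0.
exists (lker F); split=> // IJ.
have FI : (F @: I = fullv)%VS.
  apply/eqP; rewrite eqEdim subvf limg_dim_eq // dimvf.
  by rewrite dim_matrix mul1r leqnn.
apply/eqP; rewrite eqEsubv subvf; apply/subvP => z _.
have : F z \in (F @: I)%VS by rewrite FI memvf.
case/memv_imgP => x xI Fx; apply/memv_addP; exists x => //; exists (z - x).
  by rewrite memv_ker lfunB Fx subrr.
by rewrite addrC subrK.
Qed.

(** * The Killing form and derivations *)

Section Killing.
Variables (K : fieldType) (g : lieAlgType K).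
Implicit Types (x y z : g) (A C : {vspace g}).

Lemma killingC x y : killing x y = killing y x.
Proof. exact: lfun_traceC. Qed.

Lemma killing_linearr x : linear (killing x : g -> K^o).
Proof.
move=> c y z; rewrite /killing linearP comp_lfunDr -comp_lfunZr.
exact: lfun_trace_is_linear.
Qed.

Lemma killing_linearl c x y z :
  killing (c *: x + y) z = c * killing x z + killing y z.
Proof. by rewrite !(killingC _ z) killing_linearr. Qed.

(** Cyclicity of the trace moves the commutator onto [f]. Invariance of the Killing form is the case
    [f = ad z]; the nilpotency arguments use operators [f] of the form [spectral _ _]. *)
Lemma lfun_trace_commutator (x y : g) (f : 'End(g)) :
  lfun_trace (ad (lie x y) \o f)%VF =
  lfun_trace (ad x \o ((ad y \o f) - (f \o ad y)))%VF.
Proof.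
rewrite ad_lie comp_lfunDl comp_lfunNl comp_lfunDr comp_lfunNr !lfun_traceB.
congr (_ - _); first by rewrite comp_lfunA.
by rewrite -comp_lfunA (lfun_traceC (ad y)) comp_lfunA.
Qed.

Lemma killing_invariant x y z : killing (lie x y) z = killing x (lie y z).
Proof. by rewrite {1}/killing lfun_trace_commutator -ad_lie. Qed.

Lemma lie_span_ind A C (P : g -> Prop) :
  P 0 -> (forall a x y, P x -> P y -> P (a *: x + y)) ->
  (forall a b, a \in A -> b \in C -> P (lie a b)) ->
  forall x, x \in lie_span A C -> P x.
Proof.
move=> P0 Plin PAC x; have [W WP] := vspace_of_pred P0 Plin.
rewrite -WP; apply/subvP: x; apply: lie_span_subP => a b aA bC.
by apply/WP; apply: PAC.
Qed.

Definition derivation (D : 'End(g)) :=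
  forall x y, D (lie x y) = lie (D x) y + lie x (D y).

Lemma ad_derivation x : derivation (ad x).
Proof. by move=> y z; rewrite !adE lie_deriv. Qed.

Lemma derivation_ad (D : 'End(g)) x : derivation D ->
  ad (D x) = (D \o ad x)%VF - (ad x \o D)%VF.
Proof.
move=> Dd; apply/lfunP => y; rewrite add_lfunE opp_lfunE !comp_lfunE !adE Dd.
by rewrite addrK.
Qed.

(** By the Leibniz rule the shift of [D] by [a + b] sends [lie u v] to a sum of two brackets, each
    with one argument shifted; induct on the total exponent. *)
Lemma geig_lie (D : 'End(g)) a b u v : derivation D ->
  geig D a u -> geig D b v -> geig D (a + b) (lie u v).
Proof.
move=> Dd [k]; move=> uk [m].
have [n] := ubnP (k + m)%N; elim: n k m u v uk => // n IH k m u v uk.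
rewrite ltnS => kmn vm.
case: k uk kmn => [/= -> _|k uk kmn]; first by rewrite lie0l; apply: geig0.
case: m vm kmn => [/= -> _|m vm kmn]; first by rewrite lie0r; apply: geig0.
have step : shift D (a + b) (lie u v) = lie (shift D a u) v + lie u (shift D b v).
  rewrite !shiftE Dd lieBl lieBr lieZl lieZr scalerDl opprD.
  by rewrite addrACA.
suff [j wj] : geig D (a + b) (shift D (a + b) (lie u v)).
  by exists j.+1; rewrite iterSr.
rewrite step; apply: geigD.
  by apply: (IH k m.+1); rewrite // -iterSr.
by apply: (IH k.+1 m); rewrite -?addnS // -iterSr.
Qed.

End Killing.

(** * Cartan's criterion and the decomposition into simple ideals *)

Section CartanCriterion.
Variables (K : numClosedFieldType) (g : lieAlgType K).
Implicit Types (x y z : g) (I J N : {vspace g}).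

Lemma spectral_derivation (D : 'End(g)) (phi : K -> K) :
  derivation D -> {morph phi : a b / a + b} -> derivation (spectral D phi).
Proof.
move=> Dd phiD x y; move: x.
apply: (geig_full_ind (T := D)) => [|u v Du Dv|a u gu].
- by rewrite lie0l !lfun0 !lie0l addr0.
- by rewrite lieDl !lfunD Du Dv lieDl lieDl addrACA.
move: y; apply: (geig_full_ind (T := D)) => [|v w Dv Dw|b v gv].
- by rewrite lie0r !lfun0 !lie0r addr0.
- by rewrite lieDr !lfunD Dv Dw !lieDr addrACA.
rewrite (spectral_geig phi gu) (spectral_geig phi gv).
by rewrite (spectral_geig phi (geig_lie Dd gu gv)) phiD lieZl lieZr scalerDl.
Qed.

Lemma lie_span_ad_nilpotent N x : lie_ideal N ->
  (forall y z, y \in N -> z \in N -> killing y z = 0) ->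
  x \in lie_span N N -> lfun_nilpotent (ad x).
Proof.
(* [s] is a derivation preserving [N], so that [tr (ad [a, b] s)] is
   [- killing a (s b) = 0] for [a], [b] in [N]. *)
move=> idN N0 xN; apply: lfun_trace_conj_nilpotent.
set s := spectral _ _.
have sd : derivation s by apply: spectral_derivation (ad_derivation x) (rmorphD _).
have sN : stable s N by apply: spectral_stable => v vN; rewrite adE; apply: idN.
move: (s) sd sN => {}s sd sN.
apply: (lie_span_ind (P := fun x => lfun_trace (ad x \o s)%VF = 0)) xN.
- by rewrite linear0 comp_lfun0l lfun_trace0.
- by move=> c u v u0 v0; rewrite linearP comp_lfunDl -comp_lfunZl lfun_trace_is_linear u0 v0 scaler0 addr0.
move=> a b aN bN; rewrite lfun_trace_commutator -opprB -derivation_ad //.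
by rewrite comp_lfunNr lfun_traceN -/(killing a (s b)) N0 ?oppr0 // sN.
Qed.

(** The elements of [[N, N]] are ad-nilpotent, so Engel's theorem makes this algebra nilpotent. *)
Lemma cartan_criterion N : lie_ideal N ->
  (forall y z, y \in N -> z \in N -> killing y z = 0) -> lie_solvable N.
Proof.
move=> idN N0; pose N1 := lie_span N N.
have N1N : (N1 <= N)%VS by apply: lie_span_subP => x y xN yN; apply: idN.
have N1I x y : x \in N1 -> y \in N1 -> lie x y \in N1.
  by move=> /(subvP N1N) xN /(subvP N1N) yN; apply: lie_span_mem.
have [k kN] : exists k, iter k (lie_span N1) N1 = 0%VS.
  apply: engel => // x w xN _.
  have [k wk] := lie_span_ad_nilpotent idN N0 xN w.
  by exists k; rewrite -iter_ad.
(* After one bracket the derived series of [N] has entered [N1], and from there on it is dominated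
   by the lower central series of [N1]. *)
exists k.+1; apply/eqP; rewrite -subv0 -kN.
have : (iter k.+1 (fun D => lie_span D D) N <= N1)%VS /\
  (iter k.+1 (fun D => lie_span D D) N <= iter k (lie_span N1) N1)%VS.
  elim: k {kN} => [|k [IH1 IH2]]; first by split.
  split; last by rewrite iterS [X in (_ <= X)%VS]iterS; apply: lie_spanS.
  rewrite iterS; apply: subv_trans (lie_spanS IH1 IH1) _.
  by apply: lie_span_subP => x y; apply: N1I.
by case.
Qed.

Hypothesis ssg : lie_semisimple g.

(** The Killing form vanishes on the ideal [I :&: J], which is therefore solvable by Cartan's
    criterion, hence zero. *)
Lemma killing_orthogonal I : lie_ideal I ->
  exists J, [/\ lie_ideal J, forall z, z \in J <-> forall x, x \in I -> killing x z = 0,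
    (I :&: J = 0)%VS & (I + J = fullv)%VS].
Proof.
move=> idI; have [J [JE IJ]] := orthogonal_complement I (@killing_linearr _ g) (@killing_linearl _ g).
have idJ : lie_ideal J.
  move=> x y /JE yJ; apply/JE => z zI.
  by rewrite -killing_invariant yJ // lieC memvN idI.
have IJ0 : (I :&: J = 0)%VS.
  apply: ssg.
    by move=> x y; rewrite !memv_cap => /andP [yI yJ]; rewrite idI ?idJ.
  apply: cartan_criterion.
    by move=> x y; rewrite !memv_cap => /andP [yI yJ]; rewrite idI ?idJ.
  move=> y z; rewrite !memv_cap => /andP [yI _] /andP [_ /JE]; exact.
by exists J; split=> //; apply: IJ.
Qed.

Lemma killing_nondegenerate x : (forall y, killing x y = 0) -> x = 0.
Proof.
have [|J [_ JE J0 _]] := @killing_orthogonal fullv; first by move=> *; apply: memvf.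
move=> x0; apply/eqP; rewrite -memv0 -J0 capfv; apply/JE => y _.
by rewrite killingC.
Qed.

Lemma minimal_ideal J : lie_ideal J -> J != 0%VS ->
  exists I, [/\ lie_ideal I, (I <= J)%VS, I != 0%VS &
    forall L, lie_ideal L -> (L <= I)%VS -> L != 0%VS -> L = I].
Proof.
have [n] := ubnP (\dim J); elim: n J => // n IH J; rewrite ltnS => dJ idJ J0.
have [Jmin|] := pselect (forall L, lie_ideal L -> (L <= J)%VS -> L != 0%VS -> L = J).
  by exists J; split.
move=> /existsNP [L /not_implyP [idL /not_implyP [LJ /not_implyP [L0 /eqP neLJ]]]].
have [|I [idI IL I0 Imin]] := IH L _ idL L0.
  apply: leq_trans dJ; rewrite ltn_neqAle (dimv_leqif_eq LJ) neLJ.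
  exact: dimvS.
by exists I; split=> //; apply: subv_trans LJ.
Qed.

(** The basic inner product is specified on simple ideals only, so its properties have to be checked
    there. A minimal ideal [I] of [J] splits off through its Killing complement, and the induction
    continues with the rest of [J]. *)
Lemma simple_ideal_ind (P : g -> Prop) :
  P 0 -> (forall x y, P x -> P y -> P (x + y)) ->
  (forall I x, simple_ideal I -> x \in I -> P x) -> forall x, P x.
Proof.
move=> P0 PD PI x.
suff H J : lie_ideal J -> forall y, y \in J -> P y.
  exact: (H fullv (fun _ _ _ => memvf _) x (memvf x)).
have [n] := ubnP (\dim J); elim: n J => // n IH J; rewrite ltnS => dJ idJ y yJ.
have [J0|J0] := eqVneq J 0%VS.
  by move: yJ; rewrite J0 memv0 => /eqP ->.
have [I [idI IJ I0 Imin]] := minimal_ideal idJ J0.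
have [I' [idI' _ II' sII']] := killing_orthogonal idI.
have simI : simple_ideal I.
  split=> //.
    apply: contrapT => abI; case/eqP: I0; apply: ssg => //.
    exists 1%N; apply/eqP; rewrite -subv0; apply: lie_span_subP => a b aI bI.
    rewrite memv0; apply: contrapT => /negP ab0; apply: abI.
    by exists a, b.
  move=> L LI IL; have [->|L0] := eqVneq L 0%VS; [by left|right].
  (* An ideal [L] of the algebra [I] is an ideal of [g], since brackets of [I'] with [L] lie in
     [I :&: I' = 0]. *)
  apply: Imin => // z l lL; have : z \in (I + I')%VS by rewrite sII' memvf.
  case/memv_addP => i iI [i' i'I ->]; rewrite lieDl.
  have -> : lie i' l = 0.
    apply/eqP; rewrite -memv0 -II' memv_cap idI ?(subvP LI) //.
    by rewrite lieC memvN idI'.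
  by rewrite addr0 IL.
have : y \in (I + I')%VS by rewrite sII' memvf.
case/memv_addP => i iI [i' i'I yE]; rewrite yE; apply: PD; first exact: PI simI iI.
apply: (IH (J :&: I')%VS).
- apply: leq_trans dJ; rewrite ltn_neqAle (dimv_leqif_eq (capvSl _ _)).
  rewrite dimvS ?capvSl // andbT; apply: contraNneq I0 => JI'.
  rewrite -II'; apply/eqP/esym/capv_idPl; apply: subv_trans IJ _.
  by rewrite -JI' capvSr.
- by move=> a b; rewrite !memv_cap => /andP [bJ bI]; rewrite idJ ?idI'.
rewrite memv_cap i'I andbT; have -> : i' = y - i by rewrite yE addrC addKr.
by rewrite memvB // (subvP IJ).
Qed.

Lemma simple_ideal_disjoint I J x : simple_ideal I -> simple_ideal J -> I <> J ->
  x \in I -> x \in J -> x = 0.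
Proof.
move=> [idI abI Imin] [idJ _ Jmin] neIJ xI xJ.
have xIJ : x \in (I :&: J)%VS by rewrite memv_cap xI.
have stab a b : b \in (I :&: J)%VS -> lie a b \in (I :&: J)%VS.
  by rewrite !memv_cap => /andP [bI bJ]; rewrite idI ?idJ.
have [e|eI] := Imin _ (capvSl I J) (fun a b _ => @stab a b).
  by apply/eqP; rewrite -memv0 -e.
have [e|eJ] := Jmin _ (capvSr I J) (fun a b _ => @stab a b).
  by apply/eqP; rewrite -memv0 -e.
by case: neIJ; rewrite -eI eJ.
Qed.

End CartanCriterion.

(** * Inner derivations and invariant bilinear forms *)

Section InvariantForm.
Variables (K : numClosedFieldType) (g : lieAlgType K).
Implicit Types (x y z : g).

Lemma dim_dual (V : vectType K) : \dim {:'Hom(V, K^o)} = \dim {:V}.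
Proof. by rewrite !dimvf /dim /= muln1. Qed.

Lemma nondegenerate_represents (V : vectType K) (F : 'Hom(V, 'Hom(V, K^o))) :
  (forall u, (forall v, F u v = 0) -> u = 0) ->
  forall phi : 'Hom(V, K^o), exists d, F d = phi.
Proof.
move=> Fnd phi; have: phi \in limg F.
  suff -> : limg F = fullv by apply: memvf.
  apply/eqP; rewrite eqEdim subvf limg_dim_eq ?dim_dual ?leqnn //.
  apply/eqP; rewrite -subv0; apply/subvP => u; rewrite memv_cap memv_ker => /andP [_ /eqP Fx].
  by rewrite memv0; apply/eqP/Fnd => v; rewrite Fx zero_lfunE.
by case/memv_imgP => d _ ->; exists d.
Qed.

(** Let [d] represent [x |-> tr (D ad x)] through the Killing form. Then [E = D - ad d] has zero
    trace against every [ad x], and [killing (E x) y] equals the trace of [E \o ad (lie x y)];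
    nondegeneracy gives [E = 0]. *)
Lemma derivation_inner (D : 'End(g)) : lie_semisimple g -> derivation D ->
  exists d, D = ad d.
Proof.
move=> ssg Dd.
have [k kE] : exists k : g -> 'Hom(g, K^o), forall x y, k x y = killing x y.
  have /choice [k kE] : forall x, exists kx : 'Hom(g, K^o), kx =1 killing x.
    by move=> x; apply: lfun_of_linear; apply: killing_linearr.
  by exists k.
have [F FE] : exists F : 'Hom(g, 'Hom(g, K^o)), F =1 k.
  apply: lfun_of_linear => c x y; apply/lfunP => z.
  by rewrite add_lfunE scale_lfunE !kE killing_linearl.
have [phi phiE] : exists phi : 'Hom(g, K^o), phi =1 (fun x => lfun_trace (D \o ad x)%VF).
  apply: lfun_of_linear => c x y.
  by rewrite linearP comp_lfunDr -comp_lfunZr lfun_trace_is_linear.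
have [|d dE] := nondegenerate_represents (F := F) _ phi.
  by move=> x Fx; apply: (killing_nondegenerate ssg) => y; rewrite -kE -FE.
exists d; pose E := D - ad d.
have Ed : derivation E.
  move=> x y; rewrite /E !add_lfunE !opp_lfunE Dd ad_derivation lieBl lieBr.
  by rewrite opprD addrACA.
have E0 x : lfun_trace (E \o ad x)%VF = 0.
  by rewrite /E comp_lfunDl comp_lfunNl lfun_traceB -phiE -dE FE kE subrr.
apply/eqP; rewrite -subr_eq0; apply/eqP/lfunP => x; rewrite zero_lfunE -/E.
apply: (killing_nondegenerate ssg) => y.
rewrite /killing derivation_ad // comp_lfunDl comp_lfunNl lfun_traceB.
rewrite -!comp_lfunA (lfun_traceC (ad x)) -!comp_lfunA -lfun_traceB.
by rewrite -comp_lfunNr -comp_lfunDr -ad_lie E0.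
Qed.

(** By trilinearity the arguments may be taken in simple ideals. Distinct ones commute and are
    orthogonal; on a single one [B] is a multiple of the Killing form. *)
Lemma basic_invariant (H : {vspace g}) (pos : seq (cdual H))
    (B : 'Hom(g, 'Hom(g, K^o))) :
  lie_semisimple g -> basic_inner_product B pos ->
  forall x y z, B (lie x y) z = B x (lie y z).
Proof.
move=> ssg [_ _ Borth Bkill _] x y z; move: x.
apply: (simple_ideal_ind ssg) => [|u v Bu Bv|I x sI xI].
- by rewrite lie0l !lfun0 !zero_lfunE.
- by rewrite lieDl !lfunD !add_lfunE Bu Bv.
move: y; apply: (simple_ideal_ind ssg) => [|u v Bu Bv|J y sJ yJ].
- by rewrite lie0r lie0l !lfun0 !zero_lfunE.
- by rewrite lieDr lieDl !lfunD !add_lfunE Bu Bv.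
move: z; apply: (simple_ideal_ind ssg) => [|u v Bu Bv|L z sL zL].
- by rewrite lie0r !lfun0.
- by rewrite lieDr !lfunD Bu Bv.
have [idI _ _] := sI; have [idJ _ _] := sJ; have [idL _ _] := sL.
have xyI : lie x y \in I by rewrite lieC memvN idI.
have yzJ : lie y z \in J by rewrite lieC memvN idJ.
have [eIJ|neIJ] := pselect (I = J); last first.
  rewrite (simple_ideal_disjoint sI sJ neIJ xyI (idJ _ _ yJ)) lfun0 zero_lfunE.
  by rewrite (Borth I J).
have [eIL|neIL] := pselect (I = L); last first.
  rewrite (Borth I L) // (simple_ideal_disjoint sJ sL _ yzJ (idL _ _ zL)) ?lfun0 //.
  by rewrite -eIJ.
have [c cE] := Bkill I sI.
by rewrite -eIJ in yzJ; rewrite -eIL in zL; rewrite cE // cE // killing_invariant.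
Qed.

Variable (b : g -> g -> K).
Hypothesis blr : forall x, linear (b x : g -> K^o).
Hypothesis bll : forall c x y z, b (c *: x + y) z = c * b x z + b y z.
Hypothesis binv : forall x y z, b (lie x y) z = b x (lie y z).

Let b0l z : b 0 z = 0.
Proof. by have := bll (-1) 0 0 z; rewrite scaler0 addr0 mulN1r addNr. Qed.

Let b0r z : b z 0 = 0.
Proof. by have := blr z (-1) 0 0; rewrite scaler0 addr0 scaleN1r addNr. Qed.

(** For eigenvectors invariance gives [(a + a') * b u v = 0]; in general the error terms have a
    shifted argument and vanish by induction on the exponents. The form [b] will be the Killing form
    when [H] is studied and [B] when roots are. *)
Lemma form_geig c a a' u v : a + a' != 0 ->
  geig (ad c) a u -> geig (ad c) a' v -> b u v = 0.
Proof.
move=> aa' [k uk] [m]; have [n] := ubnP (k + m)%N.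
elim: n k m u v uk => // n IH k m u v uk; rewrite ltnS => kmn vm.
case: k uk kmn => [/= -> _|k uk kmn]; first exact: b0l.
case: m vm kmn => [/= -> _|m vm kmn]; first exact: b0r.
have H1 : b (shift (ad c) a u) v = 0.
  by apply: (IH k m.+1); rewrite // -iterSr.
have H2 : b u (shift (ad c) a' v) = 0.
  by apply: (IH k.+1 m); rewrite -?addnS // -iterSr.
have lcu : b (lie c u) v = - b u (lie c v).
  have := bll (-1) (lie u c) 0 v; rewrite !addr0 scaleN1r mulN1r b0l addr0 -lieC.
  by move=> ->; rewrite binv.
have e1 : a * b u v = - b u (lie c v).
  have := H1; rewrite shiftE adE addrC -scaleNr bll lcu mulNr => /eqP.
  by rewrite addrC subr_eq0 => /eqP.
have e2 : a' * b u v = b u (lie c v).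
  have := H2; rewrite shiftE adE addrC -scaleNr (blr u (- a') v) => /eqP.
  by rewrite addrC scaleNr subr_eq0 => /eqP.
by apply: (mulfI aa'); rewrite mulr0 mulrDl e1 e2 addNr.
Qed.

(** Project [y] for one [c] at a time. The discarded components are orthogonal to [x] by
    [form_geig], and commutativity keeps the conditions already achieved. *)
Lemma weight_projection (cs : seq g) (a : g -> K) x y :
  {in cs &, forall c c', lie c c' = 0} ->
  {in cs, forall c, geig (ad c) (a c) x} ->
  exists y', b x y' = b x y /\ {in cs, forall c, geig (ad c) (- a c) y'}.
Proof.
elim: cs => [|c cs IH] cC xg; first by exists y.
have [||y' [y'E y'g]] := IH.
- by move=> c1 c2 c1s c2s; apply: cC; rewrite inE ?c1s ?c2s orbT.
- by move=> c1 c1s; apply: xg; rewrite inE c1s orbT.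
have xc := xg c (mem_head _ _).
(* An indicator function makes [P] the projection onto one generalized eigenspace. *)
pose P := spectral (ad c) (fun t => (t == - a c)%:R).
have PE v : b x (P v) = b x v.
  move: v; apply: (geig_full_ind (T := ad c)) => [|u v Pu Pv|t v gv].
  - by rewrite lfun0.
  - have bD w w' : b x (w + w') = b x w + b x w'.
      by have := blr x 1 w w'; rewrite !scale1r.
    by rewrite lfunD !bD Pu Pv.
  rewrite (spectral_geig _ gv); case: eqVneq => [_|neq]; first by rewrite scale1r.
  rewrite scale0r b0r (@form_geig c (a c) t) //.
  by rewrite addrC addr_eq0.
have Pg v : geig (ad c) (- a c) (P v).
  move: v; apply: (geig_full_ind (T := ad c)) => [|u v Pu Pv|t v gv].
  - by rewrite lfun0; apply: geig0.
  - by rewrite lfunD; apply: geigD.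
  rewrite (spectral_geig _ gv); case: eqVneq => [<-|neq]; first exact: geigZ.
  by rewrite scale0r; apply: geig0.
exists (P y'); rewrite PE; split=> // c'; rewrite inE => /predU1P [->//|c's].
apply: geig_comm (y'g c' c's) => w; symmetry; apply: spectral_comm => t v.
apply: geig_comm => u; rewrite !adE lie_deriv.
by rewrite (cC c' c) ?mem_head ?inE ?c's ?orbT // lie0l add0r.
Qed.

End InvariantForm.

(** * Cartan subalgebras *)

Section CommutingOperators.
Variables (K : closedFieldType) (V : vectType K).
Implicit Types (S T : 'End(V)).

Lemma iter_comm_add S T k m v : (forall w, S (T w) = T (S w)) ->
  iter k S v = 0 -> iter m T v = 0 -> exists j, iter j (S + T) v = 0.
Proof.
move=> ST; have [n] := ubnP (k + m)%N; elim: n k m v => // n IH k m v.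
rewrite ltnS => kmn vk vm.
case: k vk kmn => [/= -> _|k vk kmn]; first by exists 0%N.
case: m vm kmn => [/= -> _|m vm kmn]; first by exists 0%N.
have Tk i w : iter i S (T w) = T (iter i S w) by elim: i => //= i ->; rewrite ST.
have Sm i w : iter i T (S w) = S (iter i T w) by elim: i => //= i ->; rewrite ST.
have [|||i Si] := IH k m.+1 (S v); rewrite -?iterSr ?Sm ?vm ?lfun0 //.
have [|||j Tj] := IH k.+1 m (T v); rewrite -?iterSr ?Tk ?vk ?lfun0 //.
  by rewrite -?addnS.
exists (i + j).+1; rewrite iterSr add_lfunE -pow_lfunE lfunD !pow_lfunE.
by rewrite (iter_lfun0_le (leq_addr j i) Si) (iter_lfun0_le (leq_addl i j) Tj) addr0.
Qed.

Lemma nilpotent_comp_comm S T : (forall w, S (T w) = T (S w)) ->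
  lfun_nilpotent S -> lfun_nilpotent (S \o T)%VF.
Proof.
move=> ST Sn v; have [k vk] := Sn v; exists k.
have Sm i w : iter i T (S w) = S (iter i T w) by elim: i => //= i ->; rewrite ST.
have -> : iter k (S \o T)%VF v = iter k T (iter k S v).
  by elim: k {vk} => //= k ->; rewrite comp_lfunE ST -Sm.
by rewrite vk iter_lfun0.
Qed.

Lemma spectral_part_nilpotent T : lfun_nilpotent (T - spectral T id).
Proof.
apply: (lfun_nilpotent_full (T := T)) => a v gv; have [k vk] := gv; exists k.
suff -> : iter k (T - spectral T id) v = iter k (shift T a) v by [].
elim: k {vk} => //= k ->; rewrite add_lfunE opp_lfunE shiftE.
by rewrite (spectral_geig _ (geig_iter_shift a k gv)).
Qed.

Lemma spectral_self_comm T phi v : T (spectral T phi v) = spectral T phi (T v).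
Proof. by apply: spectral_comm => a u; apply: geig_comm. Qed.

Lemma spectral_part_kernel T v : geig (spectral T id) 0 v -> geig T 0 v.
Proof.
rewrite /geig !shift0 => -[k vk].
have [m vm] := spectral_part_nilpotent T v.
have [|j] := iter_comm_add _ vk vm; last by rewrite subrKC; exists j.
move=> w; rewrite !add_lfunE !opp_lfunE lfunB.
by rewrite spectral_self_comm.
Qed.

End CommutingOperators.

Section CartanSubalgebra.
Variables (K : numClosedFieldType) (g : lieAlgType K) (H : {vspace g}).
Hypotheses (ssg : lie_semisimple g) (cH : cartan_subalgebra H).
Implicit Types (x y z h : g).

Let sH : lie_subalgebra H. Proof. by case: cH. Qed.

Let normH x : (forall h, h \in H -> lie x h \in H) -> x \in H.
Proof. by case: cH => _ _; apply. Qed.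

Lemma cartan_centralizer x : (forall h, h \in H -> lie h x = 0) -> x \in H.
Proof. by move=> hx; apply: normH => h hH; rewrite lieC hx // oppr0 mem0v. Qed.

Let adH_nilpotent h z : h \in H -> z \in H -> geig (ad h) 0 z.
Proof.
move=> hH zH; case: cH => _ [n nH] _; exists n; rewrite shift0 iter_ad.
apply/eqP; rewrite -memv0 -nH; elim: (n) => //= m IH.
exact: lie_span_mem.
Qed.

Let center x := x \in H /\ forall h, h \in H -> lie h x = 0.

(** The derivation on the right is inner, equal to some [ad c]. As [ad h] is nilpotent on [H] and
    [phi 0 = 0], it kills [H]; so [c] centralizes [H] and lies in it by self-normalization. *)
Let spectral_center h (phi : K -> K) : h \in H -> {morph phi : a b / a + b} ->
  exists2 c, center c & ad c = spectral (ad h) phi.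
Proof.
move=> hH phiD.
have [c cE] := derivation_inner ssg (spectral_derivation (ad_derivation h) phiD).
have phi0 : phi 0 = 0 by apply: (addrI (phi 0)); rewrite -phiD !addr0.
have cz z : z \in H -> lie z c = 0.
  move=> zH; rewrite lieC -adE -cE (spectral_geig _ (adH_nilpotent hH zH)).
  by rewrite phi0 scale0r oppr0.
by exists c => //; split=> //; apply: cartan_centralizer.
Qed.

Let ad_comm c h v : lie h c = 0 -> ad c (ad h v) = ad h (ad c v).
Proof. by move=> hc; rewrite !adE [RHS]lie_deriv hc lie0l add0r. Qed.

Let center_space : {C : {vspace g} | forall x, x \in C <-> center x}.
Proof.
apply: cid; apply: vspace_of_pred.
  by split; rewrite ?mem0v // => h _; rewrite lie0r.
move=> a u v [uH uC] [vH vC]; split; first by rewrite memvD ?memvZ.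
by move=> h hH; rewrite lieDr lieZr uC // vC // scaler0 addr0.
Qed.

Let C := sval center_space.
Let CP x : x \in C <-> center x. Proof. exact: (svalP center_space). Qed.

Let C_comm c c' : c \in C -> c' \in C -> lie c c' = 0.
Proof. by move=> /CP [cc _] /CP [_]; apply. Qed.

(** Let [Z] be the common generalized null space of the center of [H]. The semisimple part of
    [ad h], for [h] in [H], is [ad c] with [c] central, so [ad h] is nilpotent on [Z] and Engel's
    theorem applies to [H] acting on [Z]. Were [Z] not inside [H], the chain would produce a
    normalizing vector outside [H]. *)
Let center_null_in_cartan y : {in (vbasis C : seq g), forall c, geig (ad c) 0 y} -> y \in H.
Proof.
move=> yC; have [Z ZP] : exists Z : {vspace g}, forall z, z \in Z <->
    {in (vbasis C : seq g), forall c, geig (ad c) 0 z}.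
  apply: vspace_of_pred; first by move=> c _; apply: geig0.
  by move=> a u v uC vC c cC; apply: geigP; [apply: uC|apply: vC].
have ZC c z : c \in C -> z \in Z -> geig (ad c) 0 z.
  move=> cC /ZP zC; rewrite (coord_vbasis cC).
  pose Q c := c \in C /\ geig (ad c) 0 z.
  suff [] : Q (\sum_i coord (vbasis C) i c *: (vbasis C)`_i) by [].
  apply: (big_ind Q).
  - by split; [apply: mem0v|exists 1%N; rewrite shift0 /= adE lie0l].
  - move=> c1 c2 [c1C [k c1k]] [c2C [m c2m]]; split; first exact: memvD.
    rewrite !shift0 in c1k c2m.
    have [|j zj] := iter_comm_add _ c1k c2m.
      by move=> w; apply: ad_comm; apply: C_comm.
    by exists j; rewrite shift0 linearD.
  move=> i _; have ci : (vbasis C)`_i \in (vbasis C : seq g) by rewrite mem_nth ?size_tuple.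
  split; first by rewrite memvZ // vbasis_mem.
  have [k zk] := zC _ ci; exists k; move: zk; rewrite !shift0 linearZ /=.
  set t := coord _ _ _; move=> zk.
  suff -> : iter k (t *: ad (vbasis C)`_i) z = t ^+ k *: iter k (ad (vbasis C)`_i) z.
    by rewrite zk scaler0.
  elim: (k) => [|n /= ->]; first by rewrite scale1r.
  by rewrite scale_lfunE lfunZ scalerA exprS.
have HZ : (H <= Z)%VS.
  apply/subvP => h hH; apply/ZP => c /vbasis_mem /CP [_ cc].
  by apply: eigen_geig; rewrite adE lieC cc // oppr0 scale0r.
have ZH h z : h \in H -> z \in Z -> lie h z \in Z.
  move=> hH /ZP zC; apply/ZP => c cC; rewrite -adE; apply: geig_comm (zC c cC) => w.
  by symmetry; apply: ad_comm; have /CP [_ cc] := vbasis_mem cC; apply: cc.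
have [k kZ] : exists k, iter k (lie_span H) Z = 0%VS.
  apply: engel => // h z hH zZ.
  have [c cc cE] := spectral_center hH (phi := id) (fun _ _ => erefl).
  have [k zk] : geig (ad h) 0 z.
    by apply: spectral_part_kernel; rewrite -cE; apply: ZC => //; apply/CP.
  by exists k; rewrite -iter_ad -zk shift0.
apply: contrapT => /negP yH.
have [||i [v [_ vH /(_ _) Hv]]] := @lie_span_escape _ g k H Z H.
- by rewrite kZ sub0v.
- by apply: contraNN yH => /subvP sZ; apply: sZ; apply/ZP.
case/negP: vH; apply: normH => h hH; by rewrite lieC memvN Hv.
Qed.

(* Being nilpotent is thus a linear condition on [H]. *)
Let nilpotentP h : h \in H ->
  lfun_nilpotent (ad h) <-> forall c, c \in C -> killing h c = 0.
Proof.
move=> hH; split=> [hn c /CP [_ cc]|hC].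
  apply: lfun_trace_nilpotent; apply: nilpotent_comp_comm => // w.
  by symmetry; apply: ad_comm; apply: cc.
apply: lfun_trace_conj_nilpotent.
have [c cc <-] := spectral_center hH (rmorphD (@Num.conj K)).
by apply: hC; apply/CP.
Qed.

Let nilpotentD m n : m \in H -> n \in H ->
  lfun_nilpotent (ad m) -> lfun_nilpotent (ad n) -> lfun_nilpotent (ad (m + n)).
Proof.
move=> mH nH /(nilpotentP mH) mn /(nilpotentP nH) nn; apply/nilpotentP.
  exact: memvD.
by move=> c cC; have := killing_linearl 1 m n c; rewrite scale1r mn ?nn // mulr0 addr0.
Qed.

Let nilpotent_killing m n : m \in H -> n \in H ->
  lfun_nilpotent (ad m) -> lfun_nilpotent (ad n) -> killing m n = 0.
Proof.
have kxx x : lfun_nilpotent (ad x) -> killing x x = 0.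
  by move=> xn; apply: lfun_trace_nilpotent; apply: nilpotent_comp_comm.
have kD x y z : killing (x + y) z = killing x z + killing y z.
  by rewrite -{1}[x]scale1r killing_linearl mul1r.
move=> mH nH mn nn; have := kxx _ (nilpotentD mH nH mn nn).
rewrite kD !(killingC _ (m + n)) !kD !kxx // add0r addr0 (killingC n m).
by rewrite -mulr2n => /eqP; rewrite mulrn_eq0 => /eqP.
Qed.

(* The nilpotent part [h - c] of [h] lies in [H] and is orthogonal to the center
   of [H] and, by polarization, to all nilpotent elements of [H]. *)
Lemma cartan_spectral h : h \in H -> center h /\ ad h = spectral (ad h) id.
Proof.
have decomp z : z \in H -> exists2 c, center c &
    [/\ ad c = spectral (ad z) id, z - c \in H & lfun_nilpotent (ad (z - c))].
  move=> zH; have [c cc cE] := spectral_center zH (phi := id) (fun _ _ => erefl).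
  exists c => //; split=> //; first by rewrite memvB //; case: cc.
  by rewrite linearB /= cE; apply: spectral_part_nilpotent.
move=> hH; have [c cc [cE nH nn]] := decomp h hH.
suff n0 : h - c = 0 by move/eqP: n0; rewrite subr_eq0 => /eqP hc; rewrite -cE {1 2}hc.
apply: (killing_nondegenerate ssg) => y.
(* Since [h - c] commutes with the center of [H], only the null component [y'] of [y] pairs with it;
   that component lies in [H], where it splits as central plus nilpotent. *)
have [||y' [<- y'g]] := weight_projection (@killing_linearr _ g) (@killing_linearl _ g)
    (@killing_invariant _ g) (cs := vbasis C) (a := fun=> 0) (x := h - c) y.
- by move=> c1 c2 /vbasis_mem c1C /vbasis_mem c2C; apply: C_comm.
- move=> c1 /vbasis_mem /CP [_ c1c]; apply: eigen_geig.
  by rewrite adE lieC c1c // oppr0 scale0r.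
have y'H : y' \in H by apply: center_null_in_cartan => c1 /y'g; rewrite oppr0.
have [c2 cc2 [_ n2H n2n]] := decomp y' y'H.
have -> : y' = 1 *: c2 + (y' - c2) by rewrite scale1r addrC subrK.
rewrite killing_linearr.
rewrite (nilpotent_killing nH n2H nn n2n) addr0.
by rewrite scale1r; apply: (nilpotentP nH).1 => //; apply/CP.
Qed.

Lemma cartan_abelian h z : h \in H -> z \in H -> lie h z = 0.
Proof. by move=> hH /cartan_spectral [[_ zc] _]; apply: zc. Qed.

Lemma cartan_diagonalizable h a v : h \in H -> geig (ad h) a v -> lie h v = a *: v.
Proof.
by move=> /cartan_spectral [_ hE] gv; rewrite -adE hE (spectral_geig _ gv).
Qed.

Lemma root_space0 y : root_space (0 : cdual H) y -> y \in H.
Proof.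
move=> y0; apply: cartan_centralizer => h hH.
by rewrite -(vsprojK hH) y0 zero_lfunE scale0r.
Qed.

(** [y'] is the component of [y] of weight [- alpha], the only one that pairs with [x]. The
    projection yields generalized eigenvectors, which are genuine ones because [H] acts
    diagonalizably. *)
Lemma root_space_dual (b : g -> g -> K) (alpha : cdual H) x y :
  (forall x, linear (b x : g -> K^o)) ->
  (forall c x y z, b (c *: x + y) z = c * b x z + b y z) ->
  (forall x y z, b (lie x y) z = b x (lie y z)) ->
  root_space alpha x ->
  exists2 y', root_space (- alpha) y' & b x y' = b x y.
Proof.
move=> blr bll binv xa.
have [||y' [y'E y'g]] := weight_projection blr bll binv (cs := vbasis H)
    (a := fun c => alpha (vsproj H c)) (x := x) y.
- by move=> c c' /vbasis_mem cH' /vbasis_mem c'H; apply: cartan_abelian.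
- move=> c /vbasis_mem cH'; apply: eigen_geig.
  by rewrite adE -{1}(vsprojK cH') xa.
exists y' => // h; rewrite opp_lfunE.
have hE : h = \sum_i coord (vbasis H) i (vsval h) *: vsproj H (vbasis H)`_i.
  apply: subvs_inj; rewrite {1}(coord_vbasis (subvsP h)) linear_sum.
  apply: eq_bigr => i _; rewrite linearZ /= vsprojK // vbasis_mem //.
  by rewrite mem_nth ?size_tuple.
rewrite {1}(coord_vbasis (subvsP h)) [in RHS]hE lfun_sum lie_suml.
rewrite -sumrN scaler_suml; apply: eq_bigr => i _.
have ci : (vbasis H)`_i \in (vbasis H : seq g) by rewrite mem_nth ?size_tuple.
rewrite lieZl (cartan_diagonalizable (vbasis_mem ci) (y'g _ ci)) lfunZ.
by rewrite scalerA mulrN.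
Qed.

End CartanSubalgebra.

(** * Roots *)

Lemma linear_linfunE (K : fieldType) (V W : vectType K) (f : V -> W) x :
  linear f -> linfun f x = f x.
Proof.
move=> lf; pose fl : {linear V -> W} := HB.pack f (GRing.isLinear.Build K V W _ f lf).
exact: (lfunE fl).
Qed.

Lemma eigenvalue_finite (K : closedFieldType) (V : vectType K) (T : 'End(V)) :
  exists zs : seq K, forall a v, v != 0 -> T v = a *: v -> a \in zs.
Proof.
have [zs zs0] := foldr_shift_eq0 T; exists zs => a v v0 Tv.
have := zs0 v; elim: zs {zs0} => /= [/eqP|z zs IH]; first by rewrite (negPf v0).
have [c cE] : exists c, foldr (fun z => shift T z) v zs = c *: v.
  elim: (zs) => [|y ys [c /= ->]]; first by exists 1; rewrite scale1r.
  by exists (c * (a - y)); rewrite lfunZ shiftE Tv -scalerBl scalerA.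
rewrite inE; case: eqVneq => //= az Fz; apply: IH; move: Fz; rewrite cE.
rewrite lfunZ shiftE Tv -scalerBl => /eqP; rewrite !scaler_eq0 (negPf v0) subr_eq0.
by rewrite (negPf az) !orbF => /eqP ->; rewrite scale0r.
Qed.

Section LowestWeight.
Variables (K : numClosedFieldType) (g : lieAlgType K) (e f h x : g).
Hypotheses (hx : lie h x = 2 *: x) (fx : lie f x = 0) (ef : lie e f = h)
  (he : lie h e = 2 *: e).

Let u n := iter n (lie e) x.

Lemma lowest_weight_eigen n : lie h (u n) = (2 * n.+1)%:R *: u n.
Proof.
elim: n => [|n IH]; first by rewrite muln1.
rewrite [u n.+1]/= lie_deriv he IH lieZl lieZr -scalerDl -natrD.
by rewrite [in RHS]mulnS.
Qed.

Lemma lowest_weight_lower n : lie f (u n.+1) = - (n.+1 * n.+2)%:R *: u n.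
Proof.
elim: n => [|n IH].
  by rewrite /= lie_deriv [lie f e]lieC ef fx lie0r addr0 lieNl hx scaleNr.
rewrite -[u n.+2]/(lie e (u n.+1)) lie_deriv [lie f e]lieC ef lieNl lowest_weight_eigen IH lieZr.
rewrite -scaleNr -scalerDl -opprD -natrD; congr (- _%:R *: _).
by rewrite -mulnDl mulnC.
Qed.

(** If [x] were nonzero, all [u n] would be, because [f] returns from [u n.+1] to a nonzero multiple
    of [u n]. Then [ad h] would have the infinitely many eigenvalues [2 * n.+1]. *)
Lemma lowest_weight_eq0 : x = 0.
Proof.
apply: contrapT => /eqP x0; have u0 n : u n != 0.
  elim: n => // n IH; apply: contraNneq IH => un; have := lowest_weight_lower n.
  rewrite un lie0r => /esym/eqP; rewrite scaler_eq0 oppr_eq0 pnatr_eq0.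
  by rewrite muln_eq0.
have [zs zsP] := eigenvalue_finite (ad h).
have : (size (iota 0 (size zs).+1) <= size zs)%N.
  rewrite -(size_map (fun n => (2 * n.+1)%:R : K)); apply: uniq_leq_size.
    rewrite map_inj_uniq ?iota_uniq // => m n /eqP.
    by rewrite eqr_nat eqn_pmul2l // eqSS => /eqP.
  move=> _ /mapP [n _ ->]; apply: (zsP _ (u n)) => //.
  by rewrite adE lowest_weight_eigen.
by rewrite size_iota ltnn.
Qed.

End LowestWeight.

Section Roots.
Variables (K : numClosedFieldType) (g : lieAlgType K) (H : {vspace g}).
Variables (pos : seq (cdual H)) (B : 'Hom(g, 'Hom(g, K^o))) (e f : cdual H -> g).
Hypotheses (ssg : lie_semisimple g) (cH : cartan_subalgebra H)
  (posP : positive_roots pos) (BP : basic_inner_product B pos)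
  (efP : root_vectors B e f).
Implicit Types (x y z w : g) (alpha beta gamma : cdual H) (h : subvs_of H).

Let Binv x y z : B (lie x y) z = B x (lie y z).
Proof. exact: basic_invariant ssg BP x y z. Qed.

Let BC x y : B x y = B y x. Proof. by case: BP. Qed.

Let Br x : linear (B x : g -> K^o). Proof. by move=> c y z; rewrite linearP. Qed.

Let Bl (c : K) x y z : B (c *: x + y) z = c * B x z + B y z.
Proof. by rewrite linearP add_lfunE scale_lfunE. Qed.

Let BZl (c : K) x z : B (c *: x) z = c * B x z.
Proof. by rewrite lfunZ scale_lfunE. Qed.

Let BZr (c : K) x z : B x (c *: z) = c * B x z.
Proof. by rewrite lfunZ. Qed.

Lemma root_space_lie alpha beta x y :
  root_space alpha x -> root_space beta y -> root_space (alpha + beta) (lie x y).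
Proof.
by move=> xa yb h; rewrite lie_deriv xa yb lieZl lieZr -scalerDl add_lfunE.
Qed.

Lemma root_spaceZ (c : K) alpha x : root_space alpha x -> root_space alpha (c *: x).
Proof. by move=> xa h; rewrite lieZr xa !scalerA mulrC. Qed.

Lemma cartan_root_space0 h : root_space (0 : cdual H) (vsval h).
Proof. by move=> h'; rewrite zero_lfunE scale0r (cartan_abelian ssg cH) ?subvsP. Qed.

Lemma form_root_orthogonal alpha beta x y :
  root_space alpha x -> root_space beta y -> alpha + beta != 0 -> B x y = 0.
Proof.
move=> xa yb /lfunPn [h]; rewrite zero_lfunE add_lfunE => ab0.
have : B (lie x (vsval h)) y = B x (lie (vsval h) y) by apply: Binv.
rewrite lieC xa yb -scaleNr BZl BZr => /eqP.
rewrite -subr_eq0 -mulrBl mulf_eq0 => /orP [|/eqP //].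
by rewrite -opprD oppr_eq0 (negPf ab0).
Qed.

(** Against [h], any [y] may be replaced by its component of weight zero, which lies in [H]. *)
Lemma form_cartan_nondegenerate h : (forall h', B (vsval h) (vsval h') = 0) -> h = 0.
Proof.
move=> h0; apply: subvs_inj; rewrite linear0; case: BP => _ Bnd _ _ _; apply: Bnd => y.
have [y' y'0 <-] := root_space_dual ssg cH y Br Bl Binv (cartan_root_space0 h).
rewrite oppr0 in y'0; have y'H := root_space0 cH y'0.
by rewrite -(vsprojK y'H) h0.
Qed.

Let linear_cartan h : linear (fun h' : subvs_of H => B (vsval h) (vsval h') : K^o).
Proof. by move=> c u v; apply: Br. Qed.

Lemma flatE h h' : flat H B h h' = B (vsval h) (vsval h').
Proof.
rewrite /flat linear_linfunE ?linear_linfunE // => c u v.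
apply/lfunP => w; rewrite add_lfunE scale_lfunE !linear_linfunE //.
exact: Bl.
Qed.

(** Nondegeneracy on [H] makes [flat] surjective, so that the generalized inverse in [sharp] is a
    right inverse. *)
Lemma form_sharp alpha h : B (vsval (sharp H B alpha)) (vsval h) = alpha h.
Proof.
have flat0 u : (forall v, flat H B u v = 0) -> u = 0.
  by move=> uv; apply: form_cartan_nondegenerate => v; rewrite -flatE.
have [d dE] := nondegenerate_represents flat0 alpha.
rewrite -flatE /sharp limg_lfunVK // -dE; exact/memv_img/memvf.
Qed.

Lemma dual_formE alpha beta : dual_form B alpha beta = alpha (sharp H B beta).
Proof. by rewrite /dual_form form_sharp. Qed.

Lemma lie_root_opp alpha x y : root_space alpha x -> root_space (- alpha) y ->
  lie x y = B x y *: vsval (sharp H B alpha).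
Proof.
move=> xa ya; have xy0 := root_space_lie xa ya; rewrite subrr in xy0.
have xyH := root_space0 cH xy0.
rewrite -(vsprojK xyH) -linearZ; congr vsval; apply/eqP; rewrite -subr_eq0; apply/eqP.
apply: form_cartan_nondegenerate => h.
have -> : vsval (vsproj H (lie x y) - (B x y : K) *: sharp H B alpha) =
    lie x y - (B x y : K) *: vsval (sharp H B alpha).
  by rewrite linearB linearZ /= vsprojK.
rewrite lfunB add_lfunE opp_lfunE BZl form_sharp Binv lieC ya opp_lfunE.
by rewrite scaleNr opprK BZr mulrC subrr.
Qed.

Lemma sharp_neq0 alpha : alpha != 0 -> vsval (sharp H B alpha) != 0.
Proof.
apply: contraNneq => a0; apply/eqP/lfunP => h.
by rewrite -form_sharp a0 lfun0 !zero_lfunE.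
Qed.

Lemma dual_form_neq0 alpha : is_root alpha -> dual_form B alpha alpha != 0.
Proof.
case=> a0 [x xa x0]; set t := sharp H B alpha; rewrite dual_formE -/t.
have [z Bxz] : exists z, B x z != 0.
  apply: contrapT => /forallNP xz; case/eqP: x0; case: BP => _ Bnd _ _ _.
  by apply: Bnd => z; apply: contrapT => /eqP; apply: xz.
have [y ya yE] := root_space_dual ssg cH z Br Bl Binv xa.
have tE : lie x ((B x z)^-1 *: y) = vsval t.
  by rewrite lieZr (lie_root_opp xa ya) yE scalerA mulVf // scale1r.
(* If [alpha t = 0] then [t = [x, y]] commutes with [x] and [y], which makes
   [ad t] nilpotent, hence zero. *)
apply: contraTneq (sharp_neq0 a0) => at0; rewrite negbK -/t; apply/eqP.
have tn : lfun_nilpotent (ad (vsval t)).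
  apply: lfun_trace_conj_nilpotent; set s := spectral _ _.
  have {1}-> : vsval t = lie x ((B x z)^-1 *: y) by rewrite tE.
  rewrite lfun_trace_commutator (_ : _ - _ = 0) ?comp_lfun0r ?lfun_trace0 //.
  apply/eqP; rewrite subr_eq0; apply/eqP/lfunP => v; rewrite !comp_lfunE.
  apply: spectral_comm => a w; apply: geig_comm => w'; rewrite !adE.
  rewrite [RHS]lie_deriv (root_spaceZ _ ya) opp_lfunE at0 oppr0 scale0r lie0l.
  by rewrite add0r.
apply: (killing_nondegenerate ssg) => v.
suff t0 : ad (vsval t) = 0 by rewrite /killing t0 comp_lfun0l lfun_trace0.
apply/lfunP => w; rewrite adE zero_lfunE.
rewrite (cartan_diagonalizable ssg cH (a := 0)) ?subvsP ?scale0r //.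
exact: lfun_nilpotent_geig.
Qed.

Lemma root_coroot alpha : is_root alpha -> alpha (coroot B alpha) = 2.
Proof. by move=> ra; rewrite lfunZ -dual_formE -[LHS]mulrA mulVf ?mulr1 // dual_form_neq0. Qed.

Lemma form_root_vectors alpha : is_root alpha ->
  B (e alpha) (f alpha) = 2 / dual_form B alpha alpha.
Proof.
move=> ra; have [ea fa] := efP ra; rewrite (lie_root_opp ea fa) linearZ /= => /eqP.
rewrite -subr_eq0 -scalerBl scaler_eq0 (negPf (sharp_neq0 ra.1)) orbF subr_eq0.
by move/eqP.
Qed.

(** The scalar [c] makes [x - c *: e alpha] orthogonal to [f alpha], hence killed by [f alpha];
    being of weight 2 under the coroot, it vanishes by [lowest_weight_eq0]. *)
Lemma root_space_line alpha x : is_root alpha -> root_space alpha x ->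
  exists c : K, x = c *: e alpha.
Proof.
move=> ra xa; have [ea fa ef] := efP ra.
have Bef : B (e alpha) (f alpha) != 0.
  by rewrite form_root_vectors // mulf_neq0 ?invr_eq0 ?dual_form_neq0 ?pnatr_eq0.
exists (B x (f alpha) / B (e alpha) (f alpha)).
apply/eqP; rewrite -subr_eq0; apply/eqP; set c := _ / _.
have x'a : root_space alpha (x - c *: e alpha).
  by move=> h; rewrite lieBr xa (root_spaceZ _ ea) scalerBr.
apply: (@lowest_weight_eq0 _ _ (e alpha) (f alpha) (vsval (coroot B alpha))) => //.
- by rewrite x'a root_coroot.
- rewrite lieC (lie_root_opp x'a fa) lfunB add_lfunE opp_lfunE BZl.
  by rewrite divfK // subrr scale0r oppr0.
by rewrite ea root_coroot.
Qed.

Lemma is_rootN alpha : is_root alpha -> is_root (- alpha).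
Proof.
move=> ra; split; first by rewrite oppr_eq0 ra.1.
have [_ fa _] := efP ra; exists (f alpha) => //.
have := form_root_vectors ra; apply: contra_eq_neq => ->.
by rewrite lfun0 eq_sym mulf_neq0 ?invr_eq0 ?dual_form_neq0 ?pnatr_eq0.
Qed.

(** The normalization is that of the dual basis, [B (e alpha) (edual alpha) = 1]; it absorbs the
    scalar in front of the root vector part of [casimir]. *)
Definition edual alpha : g := (dual_form B alpha alpha / 2) *: f alpha.

Lemma edual_root alpha : is_root alpha -> root_space (- alpha) (edual alpha).
Proof. by move=> ra; have [_ fa _] := efP ra; apply: root_spaceZ. Qed.

Lemma form_edual alpha : is_root alpha -> B (e alpha) (edual alpha) = 1.
Proof.
move=> ra; rewrite BZr form_root_vectors // mulrA divfK ?pnatr_eq0 //.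
by rewrite divff // dual_form_neq0.
Qed.

Lemma root_space_opp_line alpha x : is_root alpha -> root_space (- alpha) x ->
  exists c : K, x = c *: edual alpha.
Proof.
move=> ra xa; have rna := is_rootN ra.
have [c xE] := root_space_line rna xa.
have [d dE] := root_space_line rna (edual_root ra).
have d0 : d != 0.
  apply: contraTneq (oner_neq0 K) => d0; rewrite negbK -(form_edual ra) dE d0.
  by rewrite scale0r lfun0.
by exists (c / d); rewrite dE scalerA divfK.
Qed.

End Roots.

(** * The Casimir elements *)

Section CommutingEndomorphisms.
Variables (K : fieldType) (U : vectType K).
Implicit Types (X Y Z : 'End(U)).

Definition lfun_comm X Y := (X \o Y = Y \o X)%VF.

Lemma lfun_comm_sym X Y : lfun_comm X Y -> lfun_comm Y X. Proof. by []. Qed.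

Lemma lfun_commD X Y Z : lfun_comm X Y -> lfun_comm X Z -> lfun_comm X (Y + Z).
Proof. by move=> XY XZ; rewrite /lfun_comm comp_lfunDl comp_lfunDr XY XZ. Qed.

Lemma lfun_commZ (c : K) X Y : lfun_comm X Y -> lfun_comm X (c *: Y).
Proof. by move=> XY; rewrite /lfun_comm -comp_lfunZl -comp_lfunZr XY. Qed.

Lemma lfun_commN X Y : lfun_comm X Y -> lfun_comm X (- Y).
Proof. by rewrite -scaleN1r; apply: lfun_commZ. Qed.

Lemma lfun_comm_comp X Y Z : lfun_comm X Y -> lfun_comm X Z -> lfun_comm X (Y \o Z)%VF.
Proof.
by move=> XY XZ; rewrite /lfun_comm comp_lfunA XY -comp_lfunA XZ comp_lfunA.
Qed.

Lemma lfun_comm_sum I (r : seq I) (P : pred I) (F : I -> 'End(U)) X :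
  (forall i, P i -> lfun_comm X (F i)) -> lfun_comm X (\sum_(i <- r | P i) F i).
Proof.
move=> XF; apply: (big_ind (lfun_comm X)) => //.
  by rewrite /lfun_comm comp_lfun0l comp_lfun0r.
exact: lfun_commD.
Qed.

Lemma comp_lfun_suml I (r : seq I) (P : pred I) (F : I -> 'End(U)) X :
  ((\sum_(i <- r | P i) F i) \o X)%VF = \sum_(i <- r | P i) (F i \o X)%VF.
Proof.
apply: (big_morph (fun Y => (Y \o X)%VF)); last exact: comp_lfun0l.
by move=> Y Z; rewrite comp_lfunDl.
Qed.

Lemma comp_lfun_sumr I (r : seq I) (P : pred I) (F : I -> 'End(U)) X :
  (X \o (\sum_(i <- r | P i) F i))%VF = \sum_(i <- r | P i) (X \o F i)%VF.
Proof.
apply: (big_morph (fun Y => (X \o Y)%VF)); last exact: comp_lfun0r.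
by move=> Y Z; rewrite comp_lfunDr.
Qed.

End CommutingEndomorphisms.

Section Casimir.
Variables (K : numClosedFieldType) (g : lieAlgType K) (H : {vspace g}).
Variables (pos : seq (cdual H)) (B : 'Hom(g, 'Hom(g, K^o))) (e f : cdual H -> g).
Variables (U : vectType K) (rho : 'Hom(g, 'End(U))).
Hypotheses (ssg : lie_semisimple g) (cH : cartan_subalgebra H)
  (posP : positive_roots pos) (BP : basic_inner_product B pos)
  (efP : root_vectors B e f) (rhoP : lie_module rho).
Implicit Types (x y z w : g) (alpha beta gamma : cdual H) (h : subvs_of H).

Let Binv x y z : B (lie x y) z = B x (lie y z).
Proof. exact: basic_invariant ssg BP x y z. Qed.

Let BC x y : B x y = B y x. Proof. by case: BP. Qed.

Let BZl (c : K) x z : B (c *: x) z = c * B x z.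
Proof. by rewrite lfunZ scale_lfunE. Qed.

(* For dual bases of an invariant form, the matrices of [ad z] in them are
   opposite transposes of each other. *)
Lemma dual_bases_comm (D : seq (g * g)) z :
  (forall p, p \in D ->
     lie z p.1 = \sum_(q <- D) (B (lie z p.1) q.2 : K) *: q.1 /\
     lie z p.2 = \sum_(q <- D) (B (lie z p.2) q.1 : K) *: q.2) ->
  lfun_comm (rho z) (\sum_(p <- D) (rho p.1 \o rho p.2)%VF).
Proof.
move=> Dz; rewrite /lfun_comm comp_lfun_sumr comp_lfun_suml.
apply/eqP; rewrite -subr_eq0 -sumrB; apply/eqP.
have stepE p : (rho z \o (rho p.1 \o rho p.2))%VF - ((rho p.1 \o rho p.2) \o rho z)%VF =
    (rho (lie z p.1) \o rho p.2)%VF + (rho p.1 \o rho (lie z p.2))%VF.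
  rewrite !rhoP comp_lfunDl comp_lfunDr comp_lfunNl comp_lfunNr -!comp_lfunA.
  by rewrite addrA subrK.
under eq_bigr do rewrite stepE.
rewrite big_split /= -[RHS](subrr (\sum_(p <- D) \sum_(q <- D)
  ((B (lie z p.1) q.2 : K) *: (rho q.1 \o rho p.2)%VF))); congr (_ + _).
  apply: eq_big_seq => p pD; rewrite {1}(Dz p pD).1 lfun_sum comp_lfun_suml.
  by apply: eq_bigr => q _; rewrite lfunZ -comp_lfunZl.
rewrite exchange_big -sumrN; apply: eq_big_seq => p pD.
rewrite {1}(Dz p pD).2 lfun_sum comp_lfun_sumr -sumrN; apply: eq_bigr => q _.
rewrite lfunZ -comp_lfunZr -scaleNr; congr (_ *: _).
by rewrite [lie z p.2]lieC lfunN opp_lfunE (Binv p.2) BC.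
Qed.

Definition casimir_pair alpha : 'End(U) :=
  ((rho (e alpha) \o rho (edual B f alpha)) + (rho (edual B f alpha) \o rho (e alpha)))%VF.

Lemma casimirE alpha : casimir B e f rho alpha = casimir_pair alpha +
  (dual_form B alpha alpha / 4) *:
    (rho (vsval (coroot B alpha)) \o rho (vsval (coroot B alpha)))%VF.
Proof.
rewrite /casimir /casimir_pair /edual (lfunZ rho _ (f alpha)) !scalerDr.
rewrite -comp_lfunZl -comp_lfunZr [in LHS]scalerA; congr (_ + _ *: _).
by rewrite -mulrA -invfM -natrM.
Qed.

Lemma weight_zero_comm alpha x y h : root_space alpha x -> root_space (- alpha) y ->
  lfun_comm (rho (vsval h)) (rho x \o rho y)%VF.
Proof.
move=> xa ya; apply/eqP; rewrite -subr_eq0; apply/eqP.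
have -> : (rho (vsval h) \o (rho x \o rho y))%VF - ((rho x \o rho y) \o rho (vsval h))%VF =
    (rho (lie (vsval h) x) \o rho y)%VF + (rho x \o rho (lie (vsval h) y))%VF.
  rewrite !rhoP comp_lfunDl comp_lfunDr comp_lfunNl comp_lfunNr -!comp_lfunA.
  by rewrite addrA subrK.
rewrite xa ya !lfunZ -comp_lfunZl -comp_lfunZr -scalerDl opp_lfunE subrr.
by rewrite scale0r.
Qed.

Lemma cartan_comm h h' : lfun_comm (rho (vsval h)) (rho (vsval h')).
Proof.
apply/eqP; rewrite -subr_eq0 -rhoP (cartan_abelian ssg cH) ?subvsP //.
by rewrite lfun0.
Qed.

Lemma casimir_cartan_comm alpha h : is_root alpha ->
  lfun_comm (rho (vsval h)) (casimir B e f rho alpha).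
Proof.
move=> ra; have [ea fa _] := efP ra; have da := edual_root efP ra.
rewrite casimirE /casimir_pair; apply: lfun_commD; first apply: lfun_commD.
- exact: weight_zero_comm ea da.
- by apply: weight_zero_comm da _; rewrite opprK.
by apply/lfun_commZ/lfun_comm_comp; apply: cartan_comm.
Qed.

Variable Q : {vspace cdual H}.

Let ps := [seq beta <- pos | beta \in Q].

Let psP beta : beta \in ps -> is_root beta /\ beta \in Q.
Proof. by case: posP => _ pr _ _; rewrite mem_filter => /andP [-> /pr]. Qed.

Let ps_uniq : uniq ps.
Proof. by case: posP => pu _ _ _; apply: filter_uniq. Qed.

Let ps_opp beta gamma : beta \in ps -> gamma \in ps -> beta + gamma != 0.
Proof.
case: posP => _ pr px _; rewrite !mem_filter => /andP [_ bp] /andP [_ gp].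
apply/negP; rewrite addr_eq0 => /eqP bg.
by have := px gamma (pr _ gp); rewrite gp -bg bp.
Qed.

(** A basis of [H] with its [B]-dual basis, the latter obtained from the coordinate forms by
    [sharp]. *)
Let hs : seq (g * g) := [seq (vsval (vsproj H (vbasis H)`_i),
  vsval (sharp H B (linfun (fun h => coord (vbasis H) i (vsval h) : K^o)))) |
    i : 'I_(\dim H) <- enum 'I_(\dim H)].

(** Each pair of root vectors is listed in both orders, so that either component runs through a
    basis of [H] plus the root spaces of the roots in [Q], and the other through the dual basis. *)
Let dual_basis : seq (g * g) := hs ++
  ([seq (e beta, edual B f beta) | beta <- ps] ++
   [seq (edual B f beta, e beta) | beta <- ps]).

Let hsE h : vsval h = \sum_(q <- hs) (B (vsval h) q.2 : K) *: q.1 /\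
  vsval h = \sum_(q <- hs) (B (vsval h) q.1 : K) *: q.2.
Proof.
have cE (i : 'I_(\dim H)) h' : linfun (fun h => coord (vbasis H) i (vsval h) : K^o) h' =
    coord (vbasis H) i (vsval h').
  apply: (linear_linfunE (f := fun h => coord (vbasis H) i (vsval h) : K^o)).
  by move=> c u v; apply: (linearP (coord (vbasis H) i)).
have hE h' : vsval h' = \sum_(q <- hs) (B (vsval h') q.2 : K) *: q.1.
  rewrite big_map big_enum {1}(coord_vbasis (subvsP h')); apply: eq_bigr => i _ /=.
  rewrite vsprojK ?vbasis_mem ?mem_nth ?size_tuple //; congr (_ *: _).
  by rewrite BC (form_sharp ssg cH BP) cE.
split=> //.
have [w wE] : exists w : subvs_of H,
    vsval w = \sum_(q <- hs) (B (vsval h) q.1 : K) *: q.2.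
  rewrite big_map; apply: (big_ind (fun x => exists w : subvs_of H, vsval w = x)).
  - by exists 0.
  - by move=> _ _ [u <-] [v <-]; exists (u + v).
  by move=> i _ /=; eexists (_ *: _).
rewrite -wE; congr vsval; apply/eqP; rewrite -subr_eq0; apply/eqP.
apply: (form_cartan_nondegenerate ssg cH BP) => h'.
have -> : vsval (h - w) = vsval h - vsval w by [].
rewrite wE lfunB add_lfunE opp_lfunE {1}(hE h') !lfun_sum sum_lfunE -sumrB.
rewrite big1 // => q _; rewrite !lfunZ scale_lfunE [B q.2 _]BC.
by rewrite [X in X - _]mulrC subrr.
Qed.

(** Only partners of weight [- gamma] pair with [w]: those from [H] if [gamma] is zero, a single
    root vector if [gamma] is a root. If [gamma] is neither, [w] is zero. *)
Let dual_basis_expand gamma w : gamma \in Q -> root_space gamma w ->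
  w = \sum_(q <- dual_basis) (B w q.2 : K) *: q.1 /\
  w = \sum_(q <- dual_basis) (B w q.1 : K) *: q.2.
Proof.
move=> gQ wg; rewrite /dual_basis !big_cat /=.
rewrite !(big_map (fun b => (e b, edual B f b))) !(big_map (fun b => (edual B f b, e b))) /=.
have orth b x : root_space b x -> gamma + b != 0 -> B w x = 0.
  exact: form_root_orthogonal ssg BP _ _ _ _ wg.
have hs0 : gamma != 0 -> \sum_(q <- hs) (B w q.2 : K) *: q.1 = 0 /\
    \sum_(q <- hs) (B w q.1 : K) *: q.2 = 0.
  move=> g0; rewrite !big_map !big1 // => i _; rewrite (orth 0) ?addr0 ?scale0r //;
  exact: cartan_root_space0.
have [g0|g0] := eqVneq gamma 0.
  have z0 F G : (forall b, b \in ps -> F b = 0) -> (forall b, b \in ps -> G b = 0) ->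
      \sum_(b <- ps) F b *: e b + \sum_(b <- ps) G b *: edual B f b = 0.
    by move=> F0 G0; rewrite !big1_seq ?addr0 // => b /andP [_ bps]; rewrite ?F0 ?G0 ?scale0r.
  have eb b : b \in ps -> (B w (e b) : K) = 0.
    move=> /psP [rb _]; have [ea _ _] := efP rb; apply: orth ea _.
    by rewrite g0 add0r rb.1.
  have db b : b \in ps -> (B w (edual B f b) : K) = 0.
    move=> /psP [rb _]; apply: orth (edual_root efP rb) _.
    by rewrite g0 add0r oppr_eq0 rb.1.
  rewrite z0 // addr0 [X in _ + X]addrC z0 // addr0.
  move: wg; rewrite g0 => /(root_space0 cH) wH; rewrite -(vsprojK wH).
  exact: hsE.
have [-> ->] := hs0 g0; rewrite !add0r.
suff wE : w = \sum_(b <- ps) (B w (edual B f b) : K) *: e b +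
    \sum_(b <- ps) (B w (e b) : K) *: edual B f b.
  by split; rewrite // addrC.
have [w0|w0] := eqVneq w 0.
  by rewrite w0 !lfun0 !big1 ?addr0 // => b _; rewrite zero_lfunE scale0r.
have rg : is_root gamma by split=> //; exists w.
have eb b : b \in ps -> gamma + b != 0 -> (B w (e b) : K) = 0.
  by move=> /psP [rb _]; have [ea _ _] := efP rb; apply: orth ea.
have db b : b \in ps -> gamma - b != 0 -> (B w (edual B f b) : K) = 0.
  by move=> /psP [rb _]; apply: orth (edual_root efP rb).
case: posP => _ pr px _; have := px gamma rg.
have [gp _|gp /= ngp] := boolP (gamma \in pos).
  have gps : gamma \in ps by rewrite mem_filter gQ.
  have [c wE] := root_space_line ssg cH BP efP rg wg.
  rewrite [X in _ = _ + X]big1_seq ?addr0; last first.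
    by move=> b /andP [_ bps]; rewrite eb ?scale0r // ps_opp.
  rewrite (bigD1_seq gamma) //= big1_seq ?addr0.
    by rewrite wE BZl (form_edual ssg cH BP efP) // mulr1.
  by move=> b /andP [bg bps]; rewrite db ?scale0r // subr_eq0 eq_sym.
have gps : - gamma \in ps by rewrite mem_filter memvN gQ.
have rng : is_root (- gamma) by have [] := psP gps.
have [c wE] : exists c : K, w = c *: edual B f (- gamma).
  by apply: (root_space_opp_line ssg cH BP efP rng); rewrite opprK.
rewrite big1_seq ?add0r; last first.
  move=> b /andP [_ bps]; rewrite db ?scale0r // -oppr_eq0 opprB addrC.
  exact: ps_opp.
rewrite (bigD1_seq (- gamma)) //= big1_seq ?addr0.
  by rewrite wE BZl BC (form_edual ssg cH BP efP) // mulr1.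
move=> b /andP [bg bps]; rewrite eb ?scale0r //.
by apply: contraNneq bg => /eqP; rewrite addrC addr_eq0.
Qed.

Let dual_basis_weight p : p \in dual_basis ->
  (exists2 gamma, gamma \in Q & root_space gamma p.1) /\
  (exists2 gamma, gamma \in Q & root_space gamma p.2).
Proof.
rewrite !mem_cat => /or3P [] /mapP.
- move=> [i _ ->] /=; split; exists 0; rewrite ?mem0v //;
  exact: cartan_root_space0.
- move=> [b /psP [rb bQ] ->] /=; have [ea _ _] := efP rb; split; first by exists b.
  by have db := edual_root efP rb; exists (- b); rewrite ?memvN.
move=> [b /psP [rb bQ] ->] /=; have [ea _ _] := efP rb; split; last by exists b.
by have db := edual_root efP rb; exists (- b); rewrite ?memvN.
Qed.

Let Omega : 'End(U) := \sum_(p <- dual_basis) (rho p.1 \o rho p.2)%VF.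

(** As [Q] is closed under addition, bracketing with [z] keeps all weights in [Q], so the brackets
    expand in the same bases. *)
Let Omega_comm gamma z : gamma \in Q -> root_space gamma z -> lfun_comm (rho z) Omega.
Proof.
move=> gQ zg; apply: dual_bases_comm => p /dual_basis_weight [[a aQ pa] [b bQ pb]].
split.
  by have [+ _] := dual_basis_expand (memvD gQ aQ) (root_space_lie zg pa).
by have [_ +] := dual_basis_expand (memvD gQ bQ) (root_space_lie zg pb).
Qed.

(* Up to elements of [rho H], which commute with [C_alpha], the sum is the
   Casimir element of the subalgebra spanned by [H] and the root spaces of the
   roots in [Q]. *)
Lemma kohno alpha : alpha \in pos -> alpha \in Q ->
  lfun_comm (casimir B e f rho alpha)
    (\sum_(beta <- pos | beta \in Q) casimir B e f rho beta).
Proof.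
move=> apos aQ; have aps : alpha \in ps by rewrite mem_filter aQ.
have [ra _] := psP aps; have [ea _ _] := efP ra.
have Ccomm h : lfun_comm (casimir B e f rho alpha) (rho (vsval h)).
  exact/lfun_comm_sym/casimir_cartan_comm.
have COmega : lfun_comm (casimir B e f rho alpha) Omega.
  have eO := lfun_comm_sym (Omega_comm aQ ea).
  have naQ : - alpha \in Q by rewrite memvN.
  have dO := lfun_comm_sym (Omega_comm naQ (edual_root efP ra)).
  have hO := lfun_comm_sym (Omega_comm (mem0v Q) (cartan_root_space0 ssg cH (coroot B alpha))).
  apply: lfun_comm_sym; rewrite casimirE /casimir_pair.
  apply: lfun_commD; last by apply/lfun_commZ/lfun_comm_comp.
  by apply: lfun_commD; apply: lfun_comm_comp.
rewrite -big_filter -/ps.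
have -> : \sum_(beta <- ps) casimir B e f rho beta =
    Omega - \sum_(p <- hs) (rho p.1 \o rho p.2)%VF +
    \sum_(beta <- ps) (dual_form B beta beta / 4) *:
      (rho (vsval (coroot B beta)) \o rho (vsval (coroot B beta)))%VF.
  rewrite /Omega /dual_basis !big_cat /= [X in _ = X + _]addrAC subrr add0r.
  rewrite !big_map -big_split /=.
  by rewrite -big_split /=; apply: eq_bigr => b _; rewrite casimirE.
apply: lfun_commD; first apply: lfun_commD => //.
  apply: lfun_commN; rewrite big_map; apply: lfun_comm_sum => i _ /=.
  by apply: lfun_comm_comp.
by apply: lfun_comm_sum => b _; apply/lfun_commZ/lfun_comm_comp.
Qed.

End Casimir.

(** * The connection *)

Section CoordinateCalculus.
Variable K : numFieldType.

Lemma to_coordK (E : vectType K) : cancel (@to_coord K E) (@of_coord K E).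
Proof. exact/rVofK/vbasisP. Qed.

Lemma to_coord_linear (E : vectType K) : linear (@to_coord K E).
Proof. exact: rVof_linear. Qed.

Lemma of_coord_linear (E : vectType K) : linear (@of_coord K E).
Proof. exact: vecof_linear. Qed.

Lemma linear_rV_differentiable n (W : normedModType K) (L : {linear 'rV[K]_n -> W}) x :
  differentiable L x.
Proof.
have -> : (L : _ -> _) = (\sum_(j < n) (fun r : 'rV[K]_n => r 0 j *: L (delta_mx 0 j))).
  apply/funext => r; rewrite fct_sumE [r in LHS]row_sum_delta linear_sum.
  by apply: eq_bigr => j _; rewrite linearZ.
apply: differentiable_sum => j; apply: differentiableZl.
exact: differentiable_coord.
Qed.

Lemma linear_rV_continuous n (W : normedModType K) (L : {linear 'rV[K]_n -> W}) :
  continuous L.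
Proof. by move=> x; apply/differentiable_continuous/linear_rV_differentiable. Qed.

Lemma linear_rV_derive n (W : normedModType K) (L : {linear 'rV[K]_n -> W}) x v :
  'D_v L x = L v.
Proof.
rewrite deriveE; last exact: linear_rV_differentiable.
by rewrite diff_lin //; apply: linear_rV_continuous.
Qed.

Lemma simple_pole_derive n (W : normedModType K) (L : {linear 'rV[K]_n -> K}) (w : W) x v :
  L x != 0 -> differentiable (fun y => (L y)^-1 *: w) x /\
  'D_v (fun y => (L y)^-1 *: w) x = (- L v / L x ^+ 2) *: w.
Proof.
move=> Lx0.
have dL : differentiable (fun y => (L y)^-1) x.
  by apply: differentiableV => //; apply: linear_rV_differentiable.
split; first exact: differentiableZl.
rewrite deriveE; last exact: differentiableZl.
rewrite diffZl // -deriveE // deriveV //; last first.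
  exact/diff_derivable/linear_rV_differentiable.
by rewrite linear_rV_derive; congr (_ *: _); rewrite /GRing.scale /= mulrC mulNr mulrN.
Qed.

(** The target [W] is arbitrary because this serves both the connection form and its contraction
    with a fixed vector. *)
Lemma simple_poles_calculus (V W : vectType K) (I : eqType) (r : seq I)
    (a : I -> 'Hom(V, K^o)) (M : I -> W) x :
  (forall i, i \in r -> (a i x : K) != 0) ->
  vdifferentiable (fun y => \sum_(i <- r) (a i y : K)^-1 *: M i) x /\
  forall u, dirderiv u (fun y => \sum_(i <- r) (a i y : K)^-1 *: M i) x =
    \sum_(i <- r) (- (a i u : K) / (a i x : K) ^+ 2) *: M i.
Proof.
move=> ax0; rewrite /vdifferentiable /dirderiv.
have [L LE] : exists L : I -> {linear 'rV[K]_(\dim {:V}) -> K},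
    forall i y, L i y = a i (of_coord y).
  have lin i : linear (fun y : 'rV[K]_(\dim {:V}) => a i (of_coord y) : K).
    by move=> c y z; rewrite of_coord_linear linearP.
  pose L i : {linear 'rV[K]_(\dim {:V}) -> K} :=
    HB.pack (fun y => a i (of_coord y) : K) (GRing.isLinear.Build K _ K _ _ (lin i)).
  by exists L.
have -> : in_coord (fun y => \sum_(i <- r) (a i y : K)^-1 *: M i) =
    fun y => \sum_(i <- r) (L i y)^-1 *: to_coord (M i).
  apply/funext => y; rewrite /in_coord /to_coord /= linear_sum.
  by apply: eq_bigr => i _; rewrite linearZ LE.
have Lx i : L i (to_coord x) = a i x by rewrite LE to_coordK.
have LE' u i : L i (to_coord u) = a i u by rewrite LE to_coordK.
have [dF DF] : differentiable (fun y => \sum_(i <- r) (L i y)^-1 *: to_coord (M i)) (to_coord x) /\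
    forall u, 'D_(to_coord u) (fun y => \sum_(i <- r) (L i y)^-1 *: to_coord (M i)) (to_coord x) =
      \sum_(i <- r) (- (a i u : K) / (a i x : K) ^+ 2) *: to_coord (M i).
  elim: r ax0 => [_|i s IH ax0].
    under eq_fun do rewrite big_nil.
    by split=> [|u]; rewrite ?big_nil ?derive_cst.
  have [|dF DF] := IH; first by move=> j js; apply: ax0; rewrite inE js orbT.
  have Li0 : L i (to_coord x) != 0 by rewrite Lx ax0 ?mem_head.
  have dpole u := simple_pole_derive (to_coord (M i)) (to_coord u) Li0.
  under eq_fun do rewrite big_cons.
  split=> [|u]; first by apply: differentiableD => //; have [] := dpole 0.
  rewrite big_cons deriveD; [|exact/diff_derivable/(dpole 0).1|exact: diff_derivable].
  by rewrite (dpole u).2 DF !LE'.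
split=> // u; rewrite DF /of_coord linear_sum; apply: eq_bigr => i _.
by rewrite linearZ /= -/(of_coord _) to_coordK.
Qed.

(** Chain rule: a linear map commutes with differentiation, and [f \o s] vanishes near [x]. *)
Lemma dirderiv_ker (V W W' : vectType K) (O : set V) (s : V -> W) (f : 'Hom(W, W')) v x :
  vopen O -> O x -> vdifferentiable s x -> (forall y, O y -> f (s y) = 0) ->
  f (dirderiv v s x) = 0.
Proof.
move=> oO Ox ds fs; rewrite /dirderiv.
have lin : linear (fun y : 'rV[K]_(\dim {:W}) => to_coord (f (of_coord y))).
  by move=> c y z; rewrite of_coord_linear linearP to_coord_linear.
pose L : {linear 'rV[K]_(\dim {:W}) -> 'rV[K]_(\dim {:W'})} :=
  HB.pack (fun y => to_coord (f (of_coord y))) (GRing.isLinear.Build K _ _ _ _ lin).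
apply: (can_inj (@to_coordK W')); rewrite [RHS]linear0.
rewrite -[LHS]/(L _) deriveE // -[LHS]/((L \o 'd _ _) _).
rewrite -[L in L \o _](@diff_lin _ _ _ L (in_coord s (to_coord x))); last exact: linear_rV_continuous.
rewrite -diff_comp //; last exact: linear_rV_differentiable.
rewrite -deriveE; last by apply: differentiable_comp => //; apply: linear_rV_differentiable.
rewrite (@near_eq_derive _ _ _ _ (cst 0)) ?derive_cst //.
have nO : nbhs (to_coord x) (@of_coord K V @^-1` O).
  by apply: open_nbhs_nbhs; split=> //=; rewrite to_coordK.
apply: filterS nO => y Oy; rewrite /= /in_coord /= to_coordK fs //.
exact: linear0.
Qed.

End CoordinateCalculus.

(** * The Arnold relation and sums over pairs of roots *)

Section Arnold.
Variables (K : fieldType) (V : vectType K) (x u v : V).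
Implicit Types a b c : 'Hom(V, K^o).

(* [(da /\ db) / (a b)] at the point [x], evaluated on [u] and [v]. *)
Definition dlog_wedge a b : K :=
  (a u : K) / (a x : K) * ((b v : K) / (b x : K)) -
  (a v : K) / (a x : K) * ((b u : K) / (b x : K)).

Lemma dlog_wedge_line (k : K) a : dlog_wedge a (k *: a) = 0.
Proof. by rewrite /dlog_wedge !scale_lfunE /GRing.scale /=; ring. Qed.

(** The three-term relation, solved so that each term on the right involves only one of [a] and [b]
    besides the reference form [a0]; this decouples the double sum over a plane. *)
Lemma arnold_relation (a0 b0 a b : 'Hom(V, K^o)) :
  a \in (<[a0]> + <[b0]>)%VS -> b \in (<[a0]> + <[b0]>)%VS ->
  (a0 x : K) != 0 -> (a x : K) != 0 -> (b x : K) != 0 ->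
  dlog_wedge a b = dlog_wedge a a0 - dlog_wedge b a0.
Proof.
case/memv_addP => _ /vlineP [a1 ->] [_ /vlineP [a2 ->] ->].
case/memv_addP => _ /vlineP [b1 ->] [_ /vlineP [b2 ->] ->].
rewrite /dlog_wedge !add_lfunE !scale_lfunE /GRing.scale /= => a0x ax bx.
by field; rewrite a0x ax bx.
Qed.

End Arnold.

Lemma big_key_eq0 (W : zmodType) (I J : eqType) (r : seq I) (k : I -> J) (F : I -> W) :
  (forall j, j \in map k r -> \sum_(i <- r | k i == j) F i = 0) ->
  \sum_(i <- r) F i = 0.
Proof.
move=> F0; have -> : \sum_(i <- r) F i =
    \sum_(i <- r) \sum_(j <- undup (map k r) | k i == j) F i.
  apply: eq_big_seq => i ir; rewrite -big_filter.
  rewrite (_ : [seq j <- _ | k i == j] = [:: k i]) ?big_seq1 //.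
  rewrite (eq_filter (a2 := pred1 (k i))); last by move=> j; rewrite /= eq_sym.
  by rewrite filter_pred1_uniq ?undup_uniq // mem_undup map_f.
rewrite (exchange_big_dep predT) //= big1_seq // => j /andP [_].
by rewrite mem_undup; apply: F0.
Qed.

Section Curvature.
Variables (K : fieldType) (V U : vectType K) (pos : seq 'Hom(V, K^o)).
Variables (C : 'Hom(V, K^o) -> 'End(U)) (x u v : V).
Hypotheses (pos0 : forall a, a \in pos -> (a x : K) != 0).
Hypothesis CQ : forall (Q : {vspace 'Hom(V, K^o)}) a, a \in pos -> a \in Q ->
  lfun_comm (C a) (\sum_(b <- pos | b \in Q) C b).
Local Notation omega := (dlog_wedge x u v).

Lemma dlog_wedge_sum_plane (a0 b0 : 'Hom(V, K^o)) : a0 \in pos ->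
  \sum_(a <- pos | a \in (<[a0]> + <[b0]>)%VS)
    \sum_(b <- pos | b \in (<[a0]> + <[b0]>)%VS) omega a b *: (C a \o C b)%VF = 0.
Proof.
move=> a0p; set Q := (_ + _)%VS.
transitivity (\sum_(a <- pos | a \in Q) \sum_(b <- pos | b \in Q)
  (omega a a0 *: (C a \o C b)%VF - omega b a0 *: (C a \o C b)%VF)).
  rewrite big_seq_cond [RHS]big_seq_cond; apply: eq_bigr => a /andP [ap aQ].
  rewrite big_seq_cond [RHS]big_seq_cond; apply: eq_bigr => b /andP [bp bQ].
  by rewrite (arnold_relation _ _ aQ bQ) ?pos0 // scalerBl.
under eq_bigr do rewrite sumrB.
(* Renaming the indices in the second half leaves [omega a a0] times the commutator of [C a] with
   the sum over [Q]. *)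
rewrite sumrB [X in _ - X]exchange_big /= -sumrB big_seq_cond big1 // => a /andP [ap aQ].
by rewrite -!scaler_sumr -comp_lfun_sumr -comp_lfun_suml CQ // subrr.
Qed.

(* Pairs of roots are grouped by the plane that they span. *)
Lemma dlog_wedge_sum :
  \sum_(a <- pos) \sum_(b <- pos) omega a b *: (C a \o C b)%VF = 0.
Proof.
transitivity (\sum_(p <- [seq (a, b) | a <- pos, b <- pos])
    omega p.1 p.2 *: (C p.1 \o C p.2)%VF); first by rewrite big_allpairs.
apply: (big_key_eq0 (k := fun p => (<[p.1]> + <[p.2]>)%VS)) => Q.
case/mapP => [[a0 b0] /allpairsP [[a1 b1] /= [a0p b0p [-> ->]]]] ->.
rewrite big_mkcond big_allpairs -[RHS](dlog_wedge_sum_plane b1 a0p).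
set Q0 := (<[a1]> + <[b1]>)%VS.
rewrite [RHS]big_mkcond; apply: eq_big_seq => a ap /=.
have nz c : c \in pos -> c != 0.
  by move=> /pos0; apply: contraNneq => ->; rewrite zero_lfunE.
have memQ c d : (<[c]> + <[d]>)%VS = Q0 -> c \in Q0 /\ d \in Q0.
  by move=> <-; split; rewrite memvE ?addvSl ?addvSr.
case: ifPn => aQ; last first.
  by rewrite big1 // => b _; case: eqP => // /memQ [aQ']; rewrite aQ' in aQ.
rewrite [RHS]big_mkcond; apply: eq_big_seq => b bp.
case: eqVneq => [/memQ [_ ->] //|neQ]; case: ifP => // bQ.
(* A pair inside [Q0] that spans a smaller space consists of proportional forms, so adding it to the
   group of [Q0] changes nothing. *)
have sQ : (<[a]> + <[b]> <= Q0)%VS by rewrite subv_add -!memvE aQ.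
have dlt : (\dim (<[a]> + <[b]>) < 2)%N.
  have : (\dim (<[a]> + <[b]>) < \dim Q0)%N.
    by rewrite ltn_neqAle (dimv_leqif_eq sQ) neQ dimvS.
  move=> /leq_trans; apply; apply: leq_trans (dimv_add_leqif _ _) _.
  by rewrite !dim_vline; do 2 case: eqP.
have /vlineP [k ->] : b \in <[a]>%VS.
  rewrite memvE; apply: subv_trans (addvSr <[a]> _) _.
  by rewrite -(dimv_leqif_sup (addvSl _ _)) eqn_leq dimvS ?addvSl //= dim_vline nz.
by rewrite dlog_wedge_line scale0r.
Qed.

End Curvature.

Section Connection.
Variables (K : numClosedFieldType) (g : lieAlgType K) (H : {vspace g}).
Variables (pos : seq (cdual H)) (B : 'Hom(g, 'Hom(g, K^o))) (e f : cdual H -> g).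
Variables (U : vectType K) (rho : 'Hom(g, 'End(U))) (h : K).
Hypotheses (ssg : lie_semisimple g) (cH : cartan_subalgebra H)
  (posP : positive_roots pos) (BP : basic_inner_product B pos)
  (efP : root_vectors B e f) (rhoP : lie_module rho).

Local Notation C := (casimir B e f rho).
Local Notation A := (casimir_connection B pos e f rho h).

Lemma casimir_connection_apply x v :
  A x v = - h *: \sum_(a <- pos) ((a v : K) / (a x : K)) *: C a.
Proof.
rewrite /casimir_connection opp_lfunE scale_lfunE scaleNr sum_lfunE.
congr (- (_ *: _)); apply: eq_bigr => a _; rewrite linear_linfunE // => c u w.
by rewrite linearP /= mulrDl scalerDl -mulrA -scalerA.
Qed.

Lemma casimir_connection_poles : exists M : cdual H -> 'Hom(subvs_of H, 'End(U)),
  (A = fun x => \sum_(a <- pos) (a x : K)^-1 *: M a) /\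
  forall a v, M a v = (- h * (a v : K)) *: C a.
Proof.
have lin (a : cdual H) : linear (fun v : subvs_of H => (- h * (a v : K)) *: C a).
  move=> c u w; have -> : (a (c *: u + w) : K) = c * (a u : K) + (a w : K) by exact: linearP.
  by rewrite mulrDr scalerDl mulrCA; move: (C a) => Ca; rewrite scalerA.
exists (fun a : cdual H => linfun (fun v : subvs_of H => (- h * (a v : K)) *: C a)).
split=> [|a v]; last exact: linear_linfunE.
apply/funext => x; apply/lfunP => v; rewrite casimir_connection_apply sum_lfunE.
rewrite scaler_sumr; apply: eq_bigr => a _.
rewrite scale_lfunE linear_linfunE //; move: (C a) => Ca.
by rewrite !scalerA [in LHS]mulrA [in LHS]mulrC.
Qed.

Lemma casimir_connection_commute x u v : h_reg x -> (A x u \o A x v = A x v \o A x u)%VF.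
Proof.
move=> xreg; case: (posP) => _ pr _ _.
apply/eqP; rewrite -subr_eq0; apply/eqP.
transitivity ((h ^+ 2) *: \sum_(a <- pos) \sum_(b <- pos)
    dlog_wedge x u v a b *: (C a \o C b)%VF); last first.
  rewrite (dlog_wedge_sum (C := C)) ?scaler0 // => [a /pr|Q a ap aQ]; first exact: xreg.
  exact: (kohno ssg cH posP BP efP rhoP ap aQ).
rewrite !casimir_connection_apply.
have comp_scale (X Y : 'End(U)) : ((- h *: X) \o (- h *: Y))%VF = h ^+ 2 *: (X \o Y)%VF.
  by rewrite -comp_lfunZl -comp_lfunZr scalerA mulrNN expr2.
rewrite !comp_scale -scalerBr; congr (_ *: _).
rewrite !comp_lfun_suml -sumrB; apply: eq_bigr => a _.
rewrite !comp_lfun_sumr -sumrB; apply: eq_bigr => b _.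
move: (C a) (C b) => Ca Cb.
by rewrite -!comp_lfunZl -!comp_lfunZr !scalerA -scalerBl.
Qed.

Lemma casimir_connection_flat : flat_connection (@h_reg _ _ H) A.
Proof.
have [M [AE ME]] := casimir_connection_poles.
have pos0 x : h_reg x -> forall a, a \in pos -> (a x : K) != 0.
  by move=> xreg a ap; case: (posP) => _ pr _ _; apply/xreg/pr.
split=> [x xreg|x u v xreg].
  by rewrite AE; apply: (simple_poles_calculus M (pos0 x xreg)).1.
have AvE w : (fun y => A y w) = fun y => \sum_(a <- pos) (a y : K)^-1 *: M a w.
  apply/funext => y; rewrite AE sum_lfunE; apply: eq_bigr => a _.
  by rewrite scale_lfunE.
rewrite /curvature !AvE (simple_poles_calculus _ (pos0 x xreg)).2.
rewrite (simple_poles_calculus _ (pos0 x xreg)).2 casimir_connection_commute //.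
(* Closedness: the coefficient [h * a u * a v / a x ^+ 2] is symmetric in [u] and [v]. *)
rewrite subrr addr0 -sumrB big1 // => a _; rewrite !ME; move: (C a) => Ca.
rewrite !scalerA.
by apply/eqP; rewrite subr_eq0; apply/eqP; congr (_ *: _); ring.
Qed.

Lemma casimir_weight_space (mu : cdual H) a u : is_root a -> weight_space rho mu u ->
  weight_space rho mu (C a u).
Proof.
move=> ra um x; have := casimir_cartan_comm (rho := rho) ssg cH efP rhoP x ra.
by move=> /lfunP /(_ u); rewrite !comp_lfunE um lfunZ.
Qed.

Lemma casimir_connection_preserves (mu : cdual H) :
  preserves_subbundle (@h_reg _ _ H) A (weight_space rho mu).
Proof.
move=> O s oO Oreg ds sm v x Ox y; rewrite /covariant lfunD.
(* For each [y] the weight space lies in the kernel of the constant map [F], so the derivative of a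
   section does too. *)
pose F : 'End(U) := rho (vsval y) - (mu y : K) *: \1%VF.
have FE w : F w = rho (vsval y) w - (mu y : K) *: w.
  by rewrite add_lfunE opp_lfunE scale_lfunE id_lfunE.
have : F (dirderiv v s x) = 0.
  apply: (dirderiv_ker v oO Ox (ds x Ox)) => z Oz.
  by rewrite FE (sm z Oz) subrr.
rewrite FE => /eqP; rewrite subr_eq0 => /eqP ->.
rewrite scalerDr; congr (_ + _).
rewrite casimir_connection_apply scale_lfunE sum_lfunE lfunZ.
rewrite [RHS]scalerA [mu y * _]mulrC -[RHS]scalerA; congr (_ *: _).
rewrite lfun_sum scaler_sumr big_seq [RHS]big_seq.
apply: eq_bigr => a ap; case: (posP) => _ pr _ _.
rewrite scale_lfunE lfunZ (casimir_weight_space (pr a ap) (sm x Ox)).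
by rewrite !scalerA mulrC.
Qed.

End Connection.

Unset Implicit Arguments.
Set Strict Implicit.
Set Printing Implicit Defensive.

Theorem theorem5p1 (R : realType) (g : lieAlgType R[i]) (H : {vspace g})
    (pos : seq (cdual H)) (B : 'Hom(g, 'Hom(g, R[i]^o)))
    (e f : cdual H -> g)
    (U : vectType R[i]) (rho : 'Hom(g, 'End(U))) (h : R[i]) :
  lie_semisimple g ->
  cartan_subalgebra H ->
  positive_roots pos ->
  basic_inner_product B pos ->
  root_vectors B e f ->
  lie_module rho ->
  flat_connection (@h_reg _ _ H) (casimir_connection B pos e f rho h) /\
  (forall mu : cdual H,
     preserves_subbundle (@h_reg _ _ H) (casimir_connection B pos e f rho h)
       (weight_space rho mu)).
Proof.
move=> ssg cH posP BP efP rhoP; split=> [|mu].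
  exact: casimir_connection_flat.
exact: casimir_connection_preserves.
Qed.
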